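(* Let $p\in(0,1]$ be fixed. For every sufficiently small $\epsilon>0$ the following holds. Consider the zero-temperature dynamics $(X_t)_{t\ge 0}$ of the Ising model on the Erdős–Rényi random graph $\mathcal G(N,p)$. For every initial configuration $X_0=X_0^{(N)}\in\{\pm1\}^N$ with magnetization $\sum_{i=1}^N X_0(i)\ge N^{\frac12-\epsilon}$, $$\lim_{N\to\infty}\mathbb P_{\mathcal J,\omega}\Big(\lim_{t\to\infty}X_t=(1,\dots,1)\Big)=1 .$$
   Context: Model. For each $N$ let $(J_{ij})_{1\le i<j\le N}$ be i.i.d. $\mathrm{Bernoulli}(p)$ random variables, $J_{ji}=J_{ij}$ (the edge indicators of $\mathcal G(N,p)$), with law $\mathbb P_{\mathcal J}$. The Hamiltonian is $H(\sigma)=-\frac1N\sum_{1\le i<j\le N}J_{ij}\sigma_i\sigma_j$ for $\sigma\in\{\pm1\}^N$. Zero-temperature dynamics. Given the couplings, $(X_t)_{t\in\mathbb N}$ is the discrete-time Markov chain on $\{\pm1\}^N$ with transition probabilities, for each $i\in\{1,\dots,N\}$, $$P(\sigma,\sigma^{(i)})=\frac1N\Big[\mathbf 1\{H(\sigma^{(i)})<H(\sigma)\}+\tfrac12\mathbf 1\{H(\sigma^{(i)})=H(\sigma)\}\Big],$$ where $\sigma^{(i)}$ is $\sigma$ with the $i$-th spin flipped; with the remaining probability the chain stays at $\sigma$. $\mathbb P_\omega$ denotes the law of the evolution of the Markov chain (given the couplings and the initial configuration), and $\mathbb P_{\mathcal J,\omega}=\mathbb P_{\mathcal J}\otimes\mathbb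 P_\omega$ is the joint law of couplings and evolution with the initial configuration held fixed (not depending on the couplings). *)

(* Defs.v *)
From HB Require Import structures.
From mathcomp Require Export all_boot all_order all_algebra.
From mathcomp Require Export all_classical all_reals all_analysis.
Export Order.TTheory GRing.Theory Num.Theory.
Export numFieldNormedType.Exports.

Set Implicit Arguments.
Unset Strict Implicit.
Unset Printing Implicit Defensive.

#[export] Set Implicit Arguments.
#[export] Unset Strict Implicit.
#[export] Unset Printing Implicit Defensive.

Local Open Scope classical_set_scope.
Local Open Scope ring_scope.

(* The pairs i < j; a coupling is read only through these, so the convention
   J_ji = J_ij needs no separate clause. *)
Definition edge (N : nat) := {ij : 'I_N * 'I_N | (ij.1 < ij.2)%N}.

Definition couplings (N : nat) := {ffun edge N -> bool}.

(* [true] encodes the spin +1 and [false] the spin -1; see [spins]. *)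
Definition config (N : nat) := {ffun 'I_N -> bool}.

Definition spins (R : realType) (N : nat) (s : config N) : 'rV[R]_N :=
  \row_i (if s i then 1 else -1).

Definition magnetization (R : realType) (N : nat) (s : config N) : R :=
  \sum_(i < N) spins R s 0 i.

Definition flip (N : nat) (i : 'I_N) (s : config N) : config N :=
  [ffun j => if j == i then ~~ s j else s j].

Definition hamiltonian (R : realType) (N : nat) (J : couplings N)
    (s : config N) : R :=
  - (N%:R^-1 * \sum_(e : edge N)
       (J e)%:R * spins R s 0 (val e).1 * spins R s 0 (val e).2).

Definition flip_prob (R : realType) (N : nat) (J : couplings N)
    (s : config N) (i : 'I_N) : R :=
  let H := hamiltonian R J in
  N%:R^-1 * ((H (flip i s) < H s)%R%:R + 2^-1 * (H (flip i s) == H s)%:R).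

(* The second summand is the remaining probability, of staying at s. *)
Definition transition (R : realType) (N : nat) (J : couplings N)
    (s s' : config N) : R :=
  \sum_(i < N) flip_prob R J s i * (s' == flip i s)%:R
  + (1 - \sum_(i < N) flip_prob R J s i) * (s' == s)%:R.

(* Joint law of i.i.d. Bernoulli(p) couplings. *)
Definition couplings_law (R : realType) (p : R) (N : nat) (J : couplings N) : R :=
  \prod_(e : edge N) bernoulli_pmf p (J e).

(* The random couplings J and the trajectory X live on a common probability
   space, and the measure P has the cylinder probabilities of the joint law of
   couplings and evolution: J is distributed as G(N,p) and, given J, X is the
   Markov chain with transition matrix [transition J] started from the
   deterministic configuration x0. *)
Definition zero_temp_dynamics (R : realType) (p : R) (N : nat) (x0 : config N)
    (d : measure_display) (T : measurableType d) (P : probability T R)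
    (J : T -> couplings N) (X : nat -> T -> config N) : Prop :=
  [/\ forall j : couplings N, measurable [set w | J w = j],
      forall (t : nat) (s : config N), measurable [set w | X t w = s] &
      forall (j : couplings N) (t : nat) (x : nat -> config N),
        P [set w | J w = j /\ forall u, (u <= t)%N -> X u w = x u] =
        (couplings_law p j * (x 0%N == x0)%:R
         * \prod_(u < t) transition R j (x u) (x u.+1))%:E].

(* Main.v *)
Require Import Defs.
From mathcomp Require Import ring lra zify.

(** Write [h i = \sum_j J_ij s_j] for the local field at [i]. An update at [i] aligns [s_i] with
the sign of [h i], a fair coin deciding when the field vanishes, so the magnetization [M] has
conditional drift [(\sum_i sgn (h i) - M) / N] and moves by steps of at most 2. The proof shows
that, with high probability over the graph alone, this drift is positive at every configuration, other
than all-plus, that the chain can reach while its magnetization stays above a slowly rising barrier;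
the potential [exp (- l M)] then does the rest.

Put [u = N ^ (1/20)], so that [N = u ^ 20] and initially [M >= u ^ 9]. Three properties of the graph
are needed, and each fails with probability at most [exp (- u)].

- [discrepancy]: by Hoeffding's inequality and a union bound over all sets [B] of vertices and all
configurations, the sum of the fields over [B] exceeds its mean minus [12 N ^ (3/2)].
If [M >= K sqrt N] with [K] large, the vertices with [h i <= 0] are then a small
fraction of all vertices, and the drift is bounded below by a constant until few minus spins are
left ([discrepancy_pull]).

- [rich]: all degrees exceed [p N / 2], so all fields are positive once few minus spins are left
([rich_field]).

- [early]: while [M] is between [u ^ 9 / 2] and [K u ^ 10 = K sqrt N], the drift is at least of order
[1 / u]. For a fixed configuration the field at [i] is a centred sum with standard deviation of order
[sqrt N], shifted by [p M], which biases its sign by at least order [M / sqrt N]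
([bin_sgr_bias]). The fields of different vertices share edges; to get
independence, the vertices are grouped in blocks of size about [u ^ 15] containing as many
plus as minus spins, and the field splits into the part coming from inside the block, which is
too small to matter for all but few vertices ([pr_inner]), and the part coming from
outside, which is independent across the block ([pr_outer]). The failure probability
[exp (- c u ^ 13)] beats the number of configurations reachable from the initial one in order
[u ^ 11] updates, which is [exp (O (u ^ 12))] ([pr_early]). At drift [1 / u], that many updates are
enough to gain [K sqrt N].

For a graph with these properties, let a barrier rise linearly from [u ^ 9 / 2] to a level above
[K sqrt N] during the first [T] updates, [T] of order [u ^ 11], and stay constant afterwards. Above the
barrier the drift is positive, and the barrier rises at half the guaranteed speed, so
[exp (- l (M - barrier))] is a supermartingale and the chain ever crosses the barrier
with probability at most [exp (- l u ^ 9 / 2)]. Above the constant barrier a second potential, vanishing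
only at the all-plus configuration, contracts geometrically ([evolve_gap]). Hence the probability
of not being at all-plus after enough updates is small ([miss_small]). At all-plus the chain is
absorbed, since all fields are positive there, which turns these bounds at fixed times into the
almost sure behaviour of trajectories ([not_absorbed_le]). *)

Local Open Scope ring_scope.

(** * Elementary bounds on the exponential and the sign *)

Section ExpBounds.
Variable R : realType.
Implicit Types x : R.

Lemma expR_le_quadratic x : x <= 2^-1 -> expR x <= 1 + x + 2 * x ^+ 2.
Proof.
move=> hx.
have h1 : 0 < 1 - x by lra.
have h2 : expR x <= (1 - x)^-1.
  rewrite -(invrK (expR x)) lef_pV2 ?posrE ?invr_gt0 ?expR_gt0 //.
  by rewrite -expRN expR_ge1Dx.
apply: (le_trans h2); rewrite -[leLHS]mul1r ler_pdivrMr //.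
have := sqr_ge0 x; nra.
Qed.

(** A substitute for Hoeffding's lemma with a worse constant. It holds for every [x], so the
exponential Markov bounds that use it need no restriction on the parameter. *)
Lemma expR_le_subgaussian x : expR x <= x + expR (2 * x ^+ 2).
Proof.
have [hx|hx] := lerP x 2^-1.
  apply: (le_trans (expR_le_quadratic hx)).
  have := expR_ge1Dx (2 * x ^+ 2); lra.
have : expR x <= expR (2 * x ^+ 2) by rewrite ler_expR; nra.
lra.
Qed.

Lemma expR_2pow k : 2 ^+ k <= expR k%:R :> R.
Proof.
rewrite -[k%:R]mulr1 expRM_natl lerXn2r ?nnegrE ?expR_ge0 //.
by have := expR_ge1Dx (1 : R); lra.
Qed.

Lemma le_sgr (a b : R) : a <= b -> Num.sg a <= Num.sg b.
Proof. by move=> h; case: (sgrP a); case: (sgrP b) => //; lra. Qed.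

Lemma sgr_bounds (y : R) : -1 <= Num.sg y /\ Num.sg y <= 1.
Proof. by case: sgrP => _; split; lra. Qed.

Lemma sgr_cases (x : R) : [\/ Num.sg x = 1 /\ 0 < x, Num.sg x = -1 /\ x < 0 | Num.sg x = 0 /\ x = 0].
Proof. by case: sgrP => h; [apply: Or33|apply: Or31|apply: Or32]. Qed.

End ExpBounds.

(** * Binomial averages *)

Section Binomial.
Variables (R : realType) (p : R).
Hypotheses (hp0 : 0 < p) (hp1 : p <= 1).

(** [bin n phi] is the expectation of [phi B] for [B] binomial with parameters [n] and [p]; the
recursion conditions on one trial. *)
Fixpoint bin (n : nat) (phi : nat -> R) : R :=
  if n is m.+1 then p * bin m (phi \o succn) + (1 - p) * bin m phi else phi 0%N.

Lemma eq_bin n phi psi : phi =1 psi -> bin n phi = bin n psi.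
Proof.
elim: n phi psi => [|n IH] phi psi h //=; rewrite (IH _ _ h) (IH _ (psi \o succn)) //.
by move=> k /=; rewrite h.
Qed.

Lemma le_bin n phi psi : (forall k, phi k <= psi k) -> bin n phi <= bin n psi.
Proof.
have p0 := ltW hp0; have p1 : 0 <= 1 - p by rewrite subr_ge0.
elim: n phi psi => [|n IH] phi psi h //=; apply: lerD; apply: ler_wpM2l => //; apply: IH => //.
by move=> k /=.
Qed.

Lemma bin_cst n c : bin n (fun=> c) = c.
Proof. by elim: n => //= n IH; rewrite IH; ring. Qed.

Lemma binD n phi psi : bin n (fun k => phi k + psi k) = bin n phi + bin n psi.
Proof.
elim: n phi psi => //= n IH phi psi.
by rewrite IH [X in p * X](IH (phi \o succn) (psi \o succn)); ring.
Qed.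

Lemma binZ n c phi : bin n (fun k => c * phi k) = c * bin n phi.
Proof.
elim: n phi => //= n IH phi.
by rewrite IH [X in p * X](IH (phi \o succn)); ring.
Qed.

Lemma bin_addn a b phi : bin (a + b) phi = bin a (fun k => bin b (fun l => phi (k + l)%N)).
Proof.
elim: a phi => // a IH phi.
rewrite addSn /= !IH; congr (_ + _).
Qed.

Lemma bin_exchange a b (phi : nat -> nat -> R) :
  bin a (fun k => bin b (phi k)) = bin b (fun l => bin a (phi^~ l)).
Proof.
elim: a phi => // a IH phi /=.
by rewrite binD !binZ IH (IH (phi \o succn)).
Qed.

Lemma bin_sum n (I : finType) (phi : I -> nat -> R) :
  bin n (fun k => \sum_i phi i k) = \sum_i bin n (phi i).
Proof.
suff h (r : seq I) : bin n (fun k => \sum_(i <- r) phi i k) = \sum_(i <- r) bin n (phi i).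
  exact: h.
elim: r => [|i r IH].
  by rewrite big_nil -[RHS](bin_cst n); apply: eq_bin => k; rewrite big_nil.
by rewrite big_cons -IH -binD; apply: eq_bin => k; rewrite big_cons.
Qed.

(** Leaving the centre [a] arbitrary is what makes the recursion close. *)
Lemma bin_variance n a :
  bin n (fun k => (k%:R - a) ^+ 2) = n%:R * p * (1 - p) + (n%:R * p - a) ^+ 2.
Proof.
elim: n a => [|n IH] a /=; first by ring.
rewrite IH (@eq_bin _ _ (fun k => (k%:R - (a - 1)) ^+ 2)); last first.
  by move=> k /=; rewrite -natr1; ring.
by rewrite IH -natr1; ring.
Qed.

Lemma bin_chebyshev n (w : R) : 0 < w ->
  bin n (fun k => (w <= `|k%:R - n%:R * p|)%R%:R) <= n%:R / w ^+ 2.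
Proof.
move=> w0.
have : bin n (fun k => (w ^- 2) * (k%:R - n%:R * p) ^+ 2) <= n%:R / w ^+ 2.
  rewrite binZ bin_variance subrr expr0n /= addr0 mulrC ler_pM2r ?invr_gt0 ?exprn_gt0 //.
  rewrite -mulrA ler_piMr //; nra.
apply: le_trans; apply: le_bin => k.
have [h|h] := lerP w `|k%:R - n%:R * p|; last by rewrite mulr_ge0 // ?invr_ge0 ?sqr_ge0.
rewrite mulrC ler_pdivlMr ?exprn_gt0 // mul1r -[leRHS]real_normK ?num_real //.
by rewrite lerXn2r // nnegrE ltW.
Qed.

(** Cut a window of length [2 w] carrying at least half of the mass into cells of length [x];
by the Cauchy-Schwarz inequality, two independent copies share one of the [n0] cells with
probability at least [(1 / 2) ^ 2 / n0]. *)
Lemma bin_concentration n n0 (x w : R) : 0 < x -> 0 < w -> n%:R <= w ^+ 2 / 2 ->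
  2 * w <= n0%:R * x ->
  (4 * n0%:R)^-1 <= bin n (fun k => bin n (fun l => (`|k%:R - l%:R| < x)%R%:R)).
Proof.
move=> x0 w0 hn hn0.
have n0_gt0 : 0 < n0%:R :> R.
  rewrite -(pmulr_lgt0 _ x0); lra.
pose c k := Num.truncn ((k%:R - n%:R * p + w) / x).
pose W k : bool := `|k%:R - n%:R * p| < w.
pose g (i : 'I_n0) k : R := (W k && (c k == i))%:R.
have Wge0 k : W k -> 0 <= (k%:R - n%:R * p + w) / x.
  by rewrite /W ltr_norml => /andP[h1 h2]; apply: divr_ge0; lra.
have sum_g k : \sum_i g i k = (W k)%:R.
  rewrite /g; case Wk: (W k) => /=; last by rewrite big1.
  have ck : (c k < n0)%N.
    rewrite truncn_lt_nat ?Wge0 // ltr_pdivrMr //.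
    by move: Wk; rewrite /W ltr_norml => /andP[h1 h2]; lra.
  rewrite (bigD1 (Ordinal ck)) //= eqxx big1 ?addr0 // => i /negbTE.
  by rewrite -val_eqE /= eq_sym => ->.
have h1 : \sum_i bin n (g i) ^+ 2
    <= bin n (fun k => bin n (fun l => (`|k%:R - l%:R| < x)%R%:R)).
  rewrite (eq_bigr (fun i => bin n (fun k => bin n (fun l => g i k * g i l)))); last first.
    move=> i _; rewrite expr2 -binZ; apply: eq_bin => k.
    by rewrite binZ mulrC.
  rewrite -bin_sum; apply: le_bin => k; rewrite -bin_sum; apply: le_bin => l.
  have [//|klx] := ltrP; first last.
    rewrite big1 // => i _; rewrite /g -natrM mulnb.
    case: andP => //= -[/andP[Wk /eqP ck] /andP[Wl /eqP cl]].
    have := truncn_itv (Wge0 _ Wk); have := truncn_itv (Wge0 _ Wl).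
    rewrite -/(c k) -/(c l) ck cl !ler_pdivlMr // !ltr_pdivrMr // -natr1 !mulrDl !mul1r.
    move=> /andP[a1 a2] /andP[b1 b2].
    suff : `|k%:R - l%:R| < x by rewrite ltNge klx.
    rewrite ltr_norml; apply/andP; split; lra.
  move=> _; apply: (@le_trans _ _ (\sum_i g i k)); last by rewrite sum_g; case: (W k).
  by apply: ler_sum => i _; rewrite /g; do 2 case: (_ && _); rewrite ?mulr1 ?mulr0 ?ler01.
apply: le_trans h1.
have s_ge : 2^-1 <= \sum_i bin n (g i).
  rewrite -bin_sum (eq_bin _ sum_g).
  have := bin_chebyshev n w0.
  have : bin n (fun k => (W k)%:R + (w <= `|k%:R - n%:R * p|)%R%:R) = 1.
    rewrite -[RHS](bin_cst n); apply: eq_bin => k; rewrite /W.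
    by case: ltrP; rewrite ?addr0 ?add0r.
  rewrite binD => h2 h3.
  have : n%:R / w ^+ 2 <= 2^-1.
    by rewrite ler_pdivrMr ?exprn_gt0 //; lra.
  lra.
(* The Cauchy-Schwarz inequality, as the nonnegativity of a sum of squares. *)
pose t : R := (2 * n0%:R)^-1.
have : 0 <= \sum_i (bin n (g i) - t) ^+ 2 by apply: sumr_ge0 => i _; apply: sqr_ge0.
rewrite (eq_bigr (fun i => bin n (g i) ^+ 2 - (2 * t * bin n (g i) - t ^+ 2))); last first.
  by move=> i _; ring.
rewrite sumrB sumrB -mulr_sumr sumr_const card_ord -[_ *+ n0]mulr_natr subr_ge0.
apply: le_trans.
have t0 : 0 < t by rewrite invr_gt0 mulr_gt0.
have tn : t * n0%:R = 2^-1 by rewrite /t; field; lra.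
have -> : (4 * n0%:R)^-1 = 2 * t * 2^-1 - t ^+ 2 * n0%:R.
  by rewrite expr2 -(mulrA t t) tn /t; field; lra.
by rewrite lerD2r ler_pM2l ?mulr_gt0.
Qed.

(** For independent [B], [B'] with the same law, exchanging them gives
[2 E sgn (B - B' + x) = E (sgn (B - B' + x) + sgn (B' - B + x))], and the bracket is 2 when
[|B - B'| < x] and never negative. *)
Lemma bin_sgr_sub n n0 (x w : R) : 0 < x -> 0 < w -> n%:R <= w ^+ 2 / 2 ->
  2 * w <= n0%:R * x ->
  (4 * n0%:R)^-1 <= bin n (fun k => bin n (fun l => Num.sg (k%:R - l%:R + x))).
Proof.
move=> x0 w0 hn hn0; apply: (le_trans (bin_concentration x0 w0 hn hn0)).
set g := bin n (fun k => bin n (fun l => Num.sg _)).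
have eg : g = bin n (fun k => bin n (fun l => Num.sg (l%:R - k%:R + x))).
  by rewrite /g bin_exchange.
suff : bin n (fun k => bin n (fun l => (`|k%:R - l%:R| < x)%R%:R)) * 2 <= g + g by lra.
rewrite mulrC -binZ {2}eg -binD; apply: le_bin => k; rewrite -binZ -binD; apply: le_bin => l.
have [h|h] := ltrP.
  move: h; rewrite ltr_norml => /andP[h1 h2].
  by rewrite mulr1 !gtr0_sg; lra.
rewrite mulr0; have [kl|kl] : (0 <= k%:R - l%:R :> R) \/ (k%:R - l%:R < 0 :> R).
  by apply/orP; rewrite leNgt orNb.
  rewrite (gtr0_sg (_ : 0 < k%:R - l%:R + x)); last by lra.
  by case: (sgrP (l%:R - _ + _)) => _; lra.
rewrite (gtr0_sg (_ : 0 < l%:R - k%:R + x)); last by lra.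
by case: (sgrP (k%:R - _ + _)) => _; lra.
Qed.

(** The first [q] trials of the larger binomial are a copy of the subtracted one, so only the [M]
surplus trials [y] matter. They exceed [2 x] except with probability at most [4 / (p ^ 2 M)], and then
the mean sign is at least that of [bin_sgr_sub]; otherwise it is at least [- 1]. *)
Lemma bin_sgr_bias q M n0 (x w : R) : 0 < x -> 0 < w -> q%:R <= w ^+ 2 / 2 ->
  2 * w <= n0%:R * x -> 4 * x <= p * M%:R ->
  (4 * n0%:R)^-1 - 8 / (p ^+ 2 * M%:R) <=
  bin (q + M) (fun k => bin q (fun l => Num.sg (k%:R - l%:R - x))).
Proof.
move=> x0 w0 hq hn0 hx.
have n0_gt0 : 0 < n0%:R :> R by rewrite -(pmulr_lgt0 _ x0); lra.
rewrite bin_addn bin_exchange.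
set g := (X in bin M X).
have gN1 y : -1 <= g y.
  rewrite /g -(bin_cst q (-1)); apply: le_bin => k; rewrite -(bin_cst q (-1)); apply: le_bin => l.
  by case: sgrP => _; lra.
have g_ge y : 2 * x <= y%:R -> (4 * n0%:R)^-1 <= g y.
  move=> hy; apply: (le_trans (bin_sgr_sub x0 w0 hq hn0)).
  apply: le_bin => k; apply: le_bin => l; apply: le_sgr.
  by rewrite natrD; lra.
set c := (4 * n0%:R)^-1 in g_ge *.
have c1 : c <= 1.
  have n01 : 1 <= n0%:R :> R by rewrite ler1n -(ltr0n R).
  rewrite invf_le1; lra.
pose W y : bool := p * M%:R / 2 <= `|y%:R - M%:R * p|.
have h : bin M (fun y => c + (-2) * (W y)%:R) <= bin M g.
  apply: le_bin => y; rewrite /W; have [hy|hy] := lerP (p * M%:R / 2) `|y%:R - M%:R * p|.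
    by have := gN1 y; rewrite mulr1; lra.
  rewrite mulr0 addr0 g_ge //; move: hy; rewrite ltr_norml => /andP[]; lra.
rewrite binD bin_cst binZ in h.
have pM0 : 0 < p * M%:R by lra.
have ch := @bin_chebyshev M (p * M%:R / 2) ltac:(lra).
have M0 : 0 < M%:R :> R by rewrite -(pmulr_rgt0 _ hp0).
apply: le_trans h; rewrite -/W in ch.
have -> : 8 / (p ^+ 2 * M%:R) = 2 * (M%:R / (p * M%:R / 2) ^+ 2).
  by field; rewrite !lt0r_neq0.
lra.
Qed.

End Binomial.

(** * Product Bernoulli measures *)

Section ProductBernoulli.
Variables (R : realType) (p : R).
Hypotheses (hp0 : 0 < p) (hp1 : p <= 1).
Variable I : finType.
Implicit Types (F G : {ffun I -> bool} -> R) (f g : {ffun I -> bool}).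

(** With [edge N] as index type this is [couplings_law p]. *)
Definition weight f : R := \prod_i bernoulli_pmf p (f i).

Definition Ex F : R := \sum_f weight f * F f.

Lemma weight_ge0 f : 0 <= weight f.
Proof. by apply: prodr_ge0 => i _; rewrite bernoulli_pmf_ge0 // ltW. Qed.

Lemma Ex_prod (G : I -> bool -> R) :
  Ex (fun f => \prod_i G i (f i)) = \prod_i (p * G i true + (1 - p) * G i false).
Proof.
rewrite (eq_bigr (fun i => \sum_b bernoulli_pmf p b * G i b)); last first.
  by move=> i _; rewrite big_bool.
rewrite bigA_distr_bigA; apply: eq_bigr => f _.
by rewrite -big_split.
Qed.

Lemma eq_Ex F G : F =1 G -> Ex F = Ex G.
Proof. by move=> h; apply: eq_bigr => f _; rewrite h. Qed.

Lemma Ex_cst c : Ex (fun=> c) = c.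
Proof.
have := Ex_prod (fun _ _ => 1); rewrite [RHS]big1; last by move=> i _; ring.
rewrite /Ex => h; rewrite -mulr_suml -[RHS]mul1r; congr (_ * _).
by rewrite -[RHS]h; apply: eq_bigr => f _; rewrite big1 // mulr1.
Qed.

Lemma le_Ex F G : (forall f, F f <= G f) -> Ex F <= Ex G.
Proof. by move=> h; apply: ler_sum => f _; apply: ler_wpM2l; rewrite ?weight_ge0. Qed.

Lemma ExD F G : Ex (fun f => F f + G f) = Ex F + Ex G.
Proof. by rewrite -big_split; apply: eq_bigr => f _; rewrite mulrDr. Qed.

Lemma ExZ c F : Ex (fun f => c * F f) = c * Ex F.
Proof. by rewrite mulr_sumr; apply: eq_bigr => f _; rewrite mulrCA. Qed.

Lemma Ex_sum (K : finType) (F : K -> {ffun I -> bool} -> R) :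
  Ex (fun f => \sum_k F k f) = \sum_k Ex (F k).
Proof. by rewrite exchange_big; apply: eq_bigr => f _; rewrite mulr_sumr. Qed.

Definition Pr (A : {ffun I -> bool} -> bool) : R := Ex (fun f => (A f)%:R).

Lemma le_Pr (A B : {ffun I -> bool} -> bool) : (forall f, A f -> B f) -> Pr A <= Pr B.
Proof.
move=> h; apply: le_Ex => f; have := h f.
by case: (A f) => [->|_] //; case: (B f).
Qed.

Lemma Pr_or (A B : {ffun I -> bool} -> bool) : Pr (fun f => A f || B f) <= Pr A + Pr B.
Proof.
rewrite -ExD; apply: le_Ex => f; case: (A f); case: (B f) => /=; lra.
Qed.

Lemma Pr_union (K : finType) (A : K -> {ffun I -> bool} -> bool) (B : pred K) c :
  (forall k, B k -> Pr (A k) <= c) ->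
  Pr (fun f => [exists k, B k && A k f]) <= #|B|%:R * c.
Proof.
move=> h; apply: (@le_trans _ _ (\sum_(k | B k) Pr (A k))); last first.
  apply: (@le_trans _ _ (\sum_(k | B k) c)); first exact: ler_sum.
  by rewrite sumr_const mulr_natl.
rewrite big_mkcond /=.
rewrite (eq_bigr (fun k => Ex (fun f => (B k && A k f)%:R))); last first.
  by move=> k _; case: (B k) => //=; rewrite Ex_cst.
rewrite -Ex_sum; apply: le_Ex => f.
case: existsP => [[k hk]|_]; last by rewrite sumr_ge0.
by rewrite (bigD1 k) //= hk lerDl sumr_ge0.
Qed.

Lemma Pr_markov (A : {ffun I -> bool} -> bool) F : (forall f, 0 <= F f) ->
  (forall f, A f -> 1 <= F f) -> Pr A <= Ex F.
Proof. by move=> F0 h; apply: le_Ex => f; have := h f; case: (A f) => [->|] //. Qed.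

(** The exponential Markov inequality with parameter [x / (4 S)]. *)
Lemma Pr_hoeffding (c : I -> R) (S x : R) : 0 <= x -> 0 < S -> \sum_i c i ^+ 2 <= S ->
  Pr (fun f => (\sum_i (f i)%:R * c i <= \sum_i p * c i - x)%R) <= expR (- (x ^+ 2 / (8 * S))).
Proof.
move=> x0 S0 hS; have [l hl] : exists l, l = x / (4 * S) by exists (x / (4 * S)).
have l0 : 0 <= l by rewrite hl divr_ge0 // mulr_ge0 // ltW.
pose F f := expR (- l * x) * \prod_i expR (l * c i * (p - (f i)%:R)).
apply: (@le_trans _ _ (Ex F)).
  apply: Pr_markov => f; first by rewrite mulr_ge0 ?expR_ge0 // prodr_ge0 // => i _; exact: expR_ge0.
  move=> h; rewrite /F -expR_sum -expRD -[leLHS]expR0 ler_expR.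
  rewrite (eq_bigr (fun i => l * (p * c i - (f i)%:R * c i))); last first.
    by move=> i _; rewrite -mulrA [c i * _]mulrC mulrBl.
  rewrite -mulr_sumr sumrB mulNr addrC subr_ge0 ler_wpM2l //; lra.
rewrite /F ExZ (Ex_prod (fun i b => expR (l * c i * (p - b%:R)))).
apply: (@le_trans _ _ (expR (- l * x) * expR (2 * l ^+ 2 * S))); last first.
  rewrite -expRD ler_expR le_eqVlt; apply/orP; left; apply/eqP.
  by rewrite hl; field; rewrite lt0r_neq0.
rewrite ler_pM2l ?expR_gt0 //.
apply: (@le_trans _ _ (expR (\sum_i 2 * l ^+ 2 * c i ^+ 2))); last first.
  by rewrite ler_expR -mulr_sumr ler_wpM2l // mulr_ge0 // sqr_ge0.
rewrite expR_sum; apply: ler_prod => i _.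
have p0 := ltW hp0; have p1 : 0 <= 1 - p by rewrite subr_ge0.
apply/andP; split; first by rewrite addr_ge0 // mulr_ge0 // expR_ge0.
have key (t : R) : -1 <= t <= 1 -> expR (l * c i * t) <= l * c i * t + expR (2 * l ^+ 2 * c i ^+ 2).
  move=> /andP[t1 t2]; apply: (le_trans (expR_le_subgaussian _)); rewrite lerD2l ler_expR.
  have -> : 2 * (l * c i * t) ^+ 2 = (2 * l ^+ 2 * c i ^+ 2) * t ^+ 2 by ring.
  apply: ler_piMr; first by apply: mulr_ge0; rewrite ?sqr_ge0 // mulr_ge0 ?sqr_ge0.
  have : 0 <= (1 - t) * (1 + t) by apply: mulr_ge0; lra.
  lra.
have k1 := key (p - 1) ltac:(apply/andP; split; lra).
have k0 := key (p - 0) ltac:(apply/andP; split; lra).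
have := ler_wpM2l p0 k1; have := ler_wpM2l p1 k0; rewrite /=; set e := expR (2 * _ * _).
lra.
Qed.

(** [F] is a function of the coordinates in [D] only. *)
Definition depends (D : pred I) F := forall f g, (forall i, D i -> f i = g i) -> F f = F g.

(** Exchanging the coordinates in [D] between two independent samples preserves their joint law. *)
Lemma Ex_indep (D : pred I) F G : depends D F -> depends (predC D) G ->
  Ex (fun f => F f * G f) = Ex F * Ex G.
Proof.
move=> hF hG.
pose mix f g := [ffun i => if D i then f i else g i] : {ffun I -> bool}.
pose sw (fg : {ffun I -> bool} * {ffun I -> bool}) := (mix fg.1 fg.2, mix fg.2 fg.1).
have swK : involutive sw.
  by case=> f g; congr (_, _); apply/ffunP => i; rewrite !ffunE; case: (D i).
have -> : Ex (fun f => F f * G f) = \sum_f \sum_g (weight f * weight g) * (F f * G f).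
  rewrite -[LHS]mulr1 -(Ex_cst 1) mulr_suml; apply: eq_bigr => f _.
  by rewrite mulr_sumr; apply: eq_bigr => g _; ring.
rewrite mulr_suml.
under [RHS]eq_bigr do rewrite mulr_sumr.
rewrite !pair_bigA /= (reindex_inj (inv_inj swK)).
apply: eq_bigr => -[f g] _ /=.
have -> : weight (mix f g) * weight (mix g f) = weight f * weight g.
  rewrite -!big_split /=; apply: eq_bigr => i _; rewrite !ffunE.
  by case: (D i) => //; rewrite mulrC.
rewrite (hF (mix f g) f); last by move=> i Di; rewrite ffunE Di.
rewrite (hG (mix f g) g); last by move=> i /negbTE /= Di; rewrite ffunE Di.
ring.
Qed.

Lemma Ex_indep_prod (K : eqType) (r : seq K) (D : K -> pred I) (F : K -> {ffun I -> bool} -> R) :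
  uniq r -> (forall k, k \in r -> depends (D k) (F k)) ->
  (forall k l i, k \in r -> l \in r -> D k i -> D l i -> k = l) ->
  Ex (fun f => \prod_(k <- r) F k f) = \prod_(k <- r) Ex (F k).
Proof.
elim: r => [|k r IH] /=.
  by move=> _ _ _; rewrite big_nil -[RHS]Ex_cst; apply: eq_Ex => f; rewrite big_nil.
case/andP=> kr ur hd hD; rewrite big_cons.
rewrite -IH //; first last.
- by move=> a b i ha hb; apply: hD; rewrite inE (ha, hb) orbT.
- by move=> a ha; apply: hd; rewrite inE ha orbT.
rewrite -(@Ex_indep (D k)).
- by apply: eq_Ex => f; rewrite big_cons.
- by apply: hd; rewrite mem_head.
move=> f g h; apply: eq_big_seq => l lr; apply: hd; first by rewrite inE lr orbT.
move=> i Dli; apply: h; apply/negP => Dki.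
by move: kr; rewrite (hD k l i) ?mem_head ?inE ?lr ?orbT.
Qed.

Definition total f (Q : {set I}) : nat := (\sum_(i in Q) f i)%N.

(** Revealing one coordinate of [Q] at a time matches the recursion defining [bin]. *)
Lemma Ex_total (Q : {set I}) (phi : nat -> R) G : depends [predC Q] G ->
  Ex (fun f => G f * phi (total f Q)) = Ex G * bin p #|Q| phi.
Proof.
move: {2}#|Q| (erefl #|Q|) => n; elim: n Q phi G => [|n IH] Q phi G cQ hG.
  rewrite cQ /= mulrC -ExZ; apply: eq_Ex => f.
  by move/eqP: cQ; rewrite cards_eq0 => /eqP ->; rewrite /total big_set0 mulrC.
have /card_gt0P[j jQ] : (0 < #|Q|)%N by rewrite cQ.
have cQ' : #|(Q :\ j)%SET| = n by move: cQ; rewrite (cardsD1 j) jQ => -[].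
have tQ f : total f Q = (f j + total f (Q :\ j)%SET)%N by rewrite /total (big_setD1 j).
pose e b (f : {ffun I -> bool}) : R := (f j == b)%:R.
have Ee b : Ex (e b) = bernoulli_pmf p b.
  have := Ex_prod (fun i c => if i == j then (c == b)%:R else 1).
  rewrite (bigD1 j) //= eqxx [X in _ * X]big1; last by move=> i /negbTE ->; ring.
  move=> h; rewrite -[RHS](_ : (p * (true == b)%:R + (1 - p) * (false == b)%:R) * 1 = _).
    rewrite -h; apply: eq_Ex => f; rewrite (bigD1 j) //= eqxx big1 ?mulr1 // => i /negbTE -> //.
  by case: b {h} => /=; ring.
rewrite (eq_Ex (G := fun f => e true f * G f * phi (total f (Q :\ j)%SET).+1
   + e false f * G f * phi (total f (Q :\ j)%SET))); last first.
  by move=> f; rewrite tQ /e; case: (f j) => /=; rewrite ?mul0r ?mul1r ?addr0 ?add0r.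
have hdep b : depends [predC (Q :\ j)%SET] (fun f => e b f * G f).
  move=> f g h; rewrite /e (h j) /= ?inE ?eqxx //; congr (_ * _).
  by apply: hG => i /= iQ; apply: h; rewrite /= !inE (negbTE iQ) andbF.
rewrite ExD (IH _ (phi \o succn) _ cQ' (hdep true)) (IH _ phi _ cQ' (hdep false)) cQ cQ' /=.
have ind b : Ex (fun f => e b f * G f) = bernoulli_pmf p b * Ex G.
  rewrite (@Ex_indep (pred1 j)) ?Ee //.
    by move=> f g h; rewrite /e (h j) /=.
  move=> f g h; apply: hG => i iQ; apply: h; apply: contra iQ => /eqP ->.
  by rewrite /= jQ.
by rewrite !ind /=; ring.
Qed.

(** The second total is handled first, with the event that the first one takes a given value as
the factor depending on the other coordinates. *)
Lemma Ex_total2 (Q Q' : {set I}) (phi : nat -> nat -> R) : [disjoint Q & Q'] ->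
  Ex (fun f => phi (total f Q) (total f Q')) = bin p #|Q| (fun k => bin p #|Q'| (phi k)).
Proof.
move=> dQ.
have h n : Ex (fun f => (total f Q == n)%:R * phi n (total f Q')) =
  bin p #|Q| (fun k => (k == n)%:R) * bin p #|Q'| (phi n).
  rewrite Ex_total; last first.
    move=> f g h; congr (_ == _)%:R; apply: eq_bigr => i iQ; rewrite h //=.
    by rewrite (disjointFr dQ iQ).
  congr (_ * _); have := @Ex_total Q (fun k => (k == n)%:R) (fun=> 1).
  rewrite Ex_cst mul1r => <- //.
  by apply: eq_Ex => f; rewrite mul1r.
have tot f : (total f Q < #|I|.+1)%N.
  rewrite ltnS /total; apply: (@leq_trans (\sum_(i in Q) 1)).
    by apply: leq_sum => i _; case: (f i).
  by rewrite sum1_card max_card.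
transitivity (\sum_(n < #|I|.+1) Ex (fun f => (total f Q == n)%:R * phi n (total f Q'))).
  rewrite -Ex_sum; apply: eq_Ex => f; rewrite (bigD1 (Ordinal (tot f))) //= eqxx mul1r.
  rewrite big1 ?addr0 // => i /negbTE; rewrite -val_eqE /= eq_sym => ->.
  by rewrite mul0r.
under eq_bigr do rewrite h.
transitivity (\sum_(n < #|I|.+1) bin p #|Q| (fun k => bin p #|Q'| (phi n) * (k == n)%:R)).
  by apply: eq_bigr => n _; rewrite binZ mulrC.
rewrite -bin_sum.
have supp : forall (m n : nat) (a b : nat -> R), (forall k, (k <= n)%N -> a k = b k) ->
    (m <= n)%N -> bin p m a = bin p m b.
  elim=> [|m IHm] n a b hab mn /=; first exact: hab.
  case: n hab mn => // n hab mn; congr (_ * _ + _ * _).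
    by apply: (IHm n) => // k kn /=; apply: hab.
  by apply: (IHm n) => // k kn; apply: hab; rewrite leqW.
apply: (supp _ #|I|); last exact: max_card.
move=> k kI; rewrite (bigD1 (inord k)) //= inordK // eqxx mulr1 big1 ?addr0 // => i.
by rewrite -val_eqE /= inordK // eq_sym => /negbTE ->; rewrite mulr0.
Qed.

End ProductBernoulli.

(** * Spins, local fields and energy differences *)

Section LocalFields.
Variables (R : realType) (N : nat).
Implicit Types (A B : {set 'I_N}) (s : config N) (J : couplings N) (i j : 'I_N).

Definition spin (b : bool) : R := if b then 1 else -1.

Lemma spinsE s i : spins R s 0 i = spin (s i).
Proof. by rewrite mxE. Qed.

Lemma magnetizationE s : magnetization R s = \sum_i spin (s i).
Proof. by apply: eq_bigr => i _; rewrite spinsE. Qed.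

Lemma sqr_spin b : spin b * spin b = 1.
Proof. by case: b; rewrite /spin; lra. Qed.

(** The contribution of the edge [e], if present, to the field that the spins of [A] exert on [i].
An edge is an ordered pair, so [i] may be either end; the two summands are never both nonzero. *)
Definition coef A s i (e : edge N) : R :=
  ((val e).1 == i)%:R * (((val e).2 \in A)%:R * spin (s (val e).2))
  + ((val e).2 == i)%:R * (((val e).1 \in A)%:R * spin (s (val e).1)).

Definition local_field A s J i : R := \sum_e (J e)%:R * coef A s i e.

Lemma edge_neq (e : edge N) : (val e).1 != (val e).2.
Proof. by rewrite -val_eqE neq_ltn (valP e). Qed.

Lemma sum_edge (F : 'I_N * 'I_N -> R) :
  \sum_(e : edge N) F (val e) = \sum_(ij : 'I_N * 'I_N | (ij.1 < ij.2)%N) F ij.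
Proof. by rewrite -(big_sub (fun ij : 'I_N * 'I_N => (ij.1 < ij.2)%N)). Qed.

Lemma sum_edges_at i (g : 'I_N -> R) :
  \sum_(e : edge N) (((val e).1 == i)%:R * g (val e).2 + ((val e).2 == i)%:R * g (val e).1)
  = \sum_(j | j != i) g j.
Proof.
rewrite (sum_edge (fun ij => (ij.1 == i)%:R * g ij.2 + (ij.2 == i)%:R * g ij.1)).
rewrite big_split /=.
rewrite -(pair_big_dep xpredT (fun a b : 'I_N => (a < b)%N) (fun a b : 'I_N => (a == i)%:R * g b)) /=.
rewrite -(pair_big_dep xpredT (fun a b : 'I_N => (a < b)%N) (fun a b : 'I_N => (b == i)%:R * g a)) /=.
have -> : \sum_(a : 'I_N) \sum_(b : 'I_N | (a < b)%N) (a == i)%:R * g b = \sum_(b : 'I_N | (i < b)%N) g b.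
  rewrite (bigD1 i) //= [X in _ + X]big1 ?addr0; last first.
    by move=> a /negbTE ->; rewrite big1 // => b _; rewrite mul0r.
  by rewrite eqxx; under eq_bigr do rewrite mul1r.
have -> : \sum_(a : 'I_N) \sum_(b : 'I_N | (a < b)%N) (b == i)%:R * g a = \sum_(a : 'I_N | (a < i)%N) g a.
  rewrite [RHS]big_mkcond; apply: eq_bigr => a _.
  rewrite big_mkcond /= (bigD1 i) //= eqxx mul1r big1 ?addr0 //.
  by move=> b /negbTE ->; rewrite mul0r if_same.
rewrite [RHS](bigID (fun j : 'I_N => (i < j)%N)) /=; congr (_ + _).
  by apply: eq_bigl => j; rewrite -val_eqE /=; case: ltngtP.
by apply: eq_bigl => j; rewrite -val_eqE /=; case: ltngtP.
Qed.

Lemma sum_coef A s i : \sum_e coef A s i e = \sum_(j in A | j != i) spin (s j).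
Proof.
rewrite (sum_edges_at i (fun j => (j \in A)%:R * spin (s j))).
rewrite [RHS]big_mkcondl /=; apply: eq_bigr => j _.
by case: (j \in A); rewrite ?mul1r ?mul0r.
Qed.

Lemma field_split A s J i :
  local_field [set: 'I_N]%SET s J i = local_field A s J i + local_field (~: A)%SET s J i.
Proof.
rewrite -big_split; apply: eq_bigr => e _ /=; rewrite -mulrDr; congr (_ * _).
rewrite /coef !inE; case: (_ \in A); case: (_ \in A) => /=; ring.
Qed.

Lemma spin_flip s i j : spin (flip i s j) = (if j == i then -1 else 1) * spin (s j).
Proof. by rewrite ffunE /spin; case: eqP => _; case: (s j) => /=; lra. Qed.

Lemma hamiltonian_flip J s i :
  hamiltonian R J (flip i s)
  = hamiltonian R J s + 2 * N%:R^-1 * (spin (s i) * local_field [set: 'I_N]%SET s J i).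
Proof.
rewrite /hamiltonian /local_field; set c := _^-1.
rewrite (eq_bigr (fun e => (J e)%:R * spins R s 0 (val e).1 * spins R s 0 (val e).2
   - 2 * (spin (s i) * ((J e)%:R * coef [set: 'I_N]%SET s i e)))).
  by rewrite sumrB -!mulr_sumr; ring.
move=> e _; rewrite !spinsE !spin_flip /coef !inE.
have := edge_neq e; case: (val e) => a b /=.
case: (eqVneq a i) => [->|_]; case: (eqVneq b i) => [->|_] /=; first by [].

- by move=> _; ring.
- by move=> _; ring.
by move=> _; ring.
Qed.

(** [Num.sg 0 = 0] accounts for the fair coin at a vanishing field. *)
Lemma flip_probE J s i : flip_prob R J s i =
  (2 * N%:R)^-1 * (1 - spin (s i) * Num.sg (local_field [set: 'I_N]%SET s J i)).
Proof.
have N0 : 0 < N%:R :> R by rewrite ltr0n (leq_trans _ (ltn_ord i)).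
rewrite /flip_prob hamiltonian_flip gtrDl -[X in _ == X]addr0 (inj_eq (addrI _)).
set h := local_field _ _ _ _; set c := 2 * _^-1.
have c0 : 0 < c by rewrite mulr_gt0 ?invr_gt0.
rewrite pmulr_rlt0 // mulf_eq0 (gt_eqF c0) /= invfM.
rewrite /spin; case: (s i); rewrite ?mul1r ?mulN1r ?oppr_lt0 ?oppr_eq0.
all: case: (sgr_cases h) => -[-> h0].
all: by rewrite ?h0 ?ltxx ?eqxx ?(lt_gtF h0) ?(lt_eqF h0) ?(gt_eqF h0) /=; field; lra.
Qed.

Lemma sum_mem A : \sum_i (i \in A)%:R = #|A|%:R :> R.
Proof.
rewrite -sum1_card natr_sum [RHS]big_mkcond; apply: eq_bigr => i _.
by case: (i \in A).
Qed.

(** Only edges inside [A] contribute, each with a coefficient at most 2 in absolute value, because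
both of its ends may lie in [B]. *)
Lemma sum_coef_sqr A B s : B \subset A ->
  \sum_e (\sum_(i in B) coef A s i e) ^+ 2 <= 4 * #|A|%:R ^+ 2.
Proof.
move=> BA.
pose F (ij : 'I_N * 'I_N) : R := 4 * ((ij.1 \in A)%:R * (ij.2 \in A)%:R).
apply: (@le_trans _ _ (\sum_(e : edge N) F (val e))).
  apply: ler_sum => e _.
  rewrite (_ : \sum_(i in B) coef A s i e =
    ((val e).1 \in B)%:R * (((val e).2 \in A)%:R * spin (s (val e).2))
    + ((val e).2 \in B)%:R * (((val e).1 \in A)%:R * spin (s (val e).1))); last first.
    rewrite big_split /= -!mulr_suml; congr (_ * _ + _ * _).
      rewrite big_mkcond (bigD1 (val e).1) //= eqxx big1 ?addr0; first by case: ifP.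
      by move=> j /negbTE h; rewrite eq_sym h if_same.
    rewrite big_mkcond (bigD1 (val e).2) //= eqxx big1 ?addr0; first by case: ifP.
    by move=> j /negbTE h; rewrite eq_sym h if_same.
  rewrite /F; set a := (val e).1; set b := (val e).2.
  have ha := fintype.subsetP BA a; have hb := fintype.subsetP BA b.
  rewrite /spin; move: ha hb; case: (a \in B) => [->//|_]; case: (b \in B) => [->//|_];
   by case: (_ \in A) => //=; case: (_ \in A) => //=; do 2 case: (s _); rewrite ?expr2; lra.
rewrite (sum_edge F).
apply: (@le_trans _ _ (\sum_ij F ij)).
  rewrite big_mkcond; apply: ler_sum => ij _; case: ifP => // _.
  by rewrite /F !mulr_ge0.
rewrite -mulr_sumr ler_wpM2l // -(pair_bigA _ (fun i j => (i \in A)%:R * (j \in A)%:R)) /=.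
under eq_bigr do rewrite -mulr_sumr.
by rewrite -mulr_suml sum_mem.
Qed.

End LocalFields.

(** * Concentration on one block of vertices *)

Section BlockEstimates.
Variables (R : realType) (p : R) (N : nat).
Hypotheses (hp0 : 0 < p) (hp1 : p <= 1).
Implicit Types (A B : {set 'I_N}) (s : config N) (J : couplings N) (i j : 'I_N).

Lemma field_hoeffding A B s (y : R) : B \subset A -> (0 < #|A|)%N -> 0 <= y ->
  Pr p (fun J => (\sum_(i in B) local_field R A s J i
     <= p * (\sum_(i in B) \sum_(j in A | j != i) spin R (s j)) - y)%R)
  <= expR (- (y ^+ 2 / (32 * #|A|%:R ^+ 2))).
Proof.
move=> BA A0 y0; pose c e := \sum_(i in B) coef R A s i e.
have S0 : 0 < 4 * #|A|%:R ^+ 2 :> R by rewrite mulr_gt0 // exprn_gt0 // ltr0n.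
have := Pr_hoeffding hp0 hp1 y0 S0 (sum_coef_sqr R s BA).
have -> : 8 * (4 * #|A|%:R ^+ 2) = 32 * #|A|%:R ^+ 2 :> R by ring.
apply: le_trans; apply: le_Pr => // J.
have -> : \sum_(i in B) local_field R A s J i = \sum_e (J e)%:R * c e.
  rewrite exchange_big /=; apply: eq_bigr => e _; by rewrite mulr_sumr.
rewrite -mulr_sumr exchange_big /=.
by under [X in _ -> (_ <= p * X - y)%R]eq_bigr do rewrite sum_coef.
Qed.

(** If the set [B] of vertices of [A] with a strongly negative inner field were large, the inner fields
would have an exceptionally small sum over [B]. As [A] is balanced that sum has mean at least [- #|B|],
and a union bound over the subsets [B] of [A] is affordable. *)
Lemma pr_inner A s (x k : R) : \sum_(j in A) spin R (s j) = 0 -> (0 < #|A|)%N -> 2 <= x -> 0 <= k ->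
  Pr p (fun J => (k <= #|[set i in A | (local_field R A s J i < - x)%R]%SET|%:R)%R)
  <= 2 ^+ #|A| * expR (- ((k * x / 2) ^+ 2 / (32 * #|A|%:R ^+ 2))).
Proof.
move=> hbal A0 x2 k0.
pose E B J : bool := (\sum_(i in B) local_field R A s J i
     <= p * (\sum_(i in B) \sum_(j in A | j != i) spin R (s j)) - k * x / 2)%R.
have := @Pr_union R p hp0 hp1 _ {set 'I_N} (fun B J => E B J) (mem (powerset A))
  (expR (- ((k * x / 2) ^+ 2 / (32 * #|A|%:R ^+ 2)))).
rewrite card_powerset natrX; move=> h; apply: le_trans (h _); last first.
  move=> B; rewrite inE powersetE => BA; apply: field_hoeffding => //.
  by rewrite divr_ge0 // mulr_ge0 //; lra.
apply: le_Pr => // J; set B := [set i in A | _]%SET => hk.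
apply/existsP; exists B; rewrite /= powersetE; apply/andP; split.
  by apply/fintype.subsetP => i; rewrite inE => /andP[].
rewrite /E [X in p * X](eq_bigr (fun i => - spin R (s i))); last first.
  move=> i; rewrite inE => /andP[iA _]; apply/eqP; rewrite -subr_eq0 opprK addrC.
  by move: hbal; rewrite (bigD1 i) //= => ->.
have h1 : \sum_(i in B) local_field R A s J i <= \sum_(i in B) - x.
  by apply: ler_sum => i; rewrite inE => /andP[_ /ltW].
have h2 : \sum_(i in B) -1 <= \sum_(i in B) - spin R (s i).
  by apply: ler_sum => i _; rewrite /spin; case: (s i); lra.
move: h1 h2; rewrite !sumr_const -(mulr_natr (- x)) -(mulr_natr (-1)); set b := #|B|%:R in hk *.
set u := \sum_(i in B) - _ => h1 h2.
have b0 : 0 <= b by rewrite ler0n.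
have h3 : p * (-1 * b) <= p * u by rewrite ler_wpM2l // ltW.
have h4 : p * b <= b by rewrite ler_piMl.
have h5 : k * x <= b * x by rewrite ler_wpM2r //; lra.
have h6 : 2 * b <= x * b by rewrite ler_wpM2r.
lra.
Qed.

Definition outer_edges A s i (b : bool) : {set edge N} :=
  [set e | [&& (val e).1 == i, (val e).2 \notin A & s (val e).2 == b]
        || [&& (val e).2 == i, (val e).1 \notin A & s (val e).1 == b]]%SET.

Lemma card_outer_edges A s i b : i \in A ->
  #|outer_edges A s i b| = #|[set j | (j \notin A) && (s j == b)]%SET|.
Proof.
move=> iA; apply/eqP; rewrite -(eqr_nat R) -!sum1_card !natr_sum.
rewrite (eq_bigr (fun e : edge N => 1 : R)) // big_mkcond /=.
rewrite (eq_bigr (fun e : edge N =>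
    ((val e).1 == i)%:R * (((val e).2 \notin A) && (s (val e).2 == b))%:R
  + ((val e).2 == i)%:R * (((val e).1 \notin A) && (s (val e).1 == b))%:R)); last first.
  move=> e _; rewrite inE; have := edge_neq e; case: (val e) => a c /=.
  case: (eqVneq a i) => [->|_]; case: (eqVneq c i) => [->|_] //=;
    rewrite ?mul1r ?mul0r ?addr0 ?add0r ?orbF //.
  - by case: (_ && _).
  - by case: (_ && _).
rewrite (sum_edges_at i (fun j => ((j \notin A) && (s j == b))%:R : R)).
rewrite big_mkcond [X in _ == X]big_mkcond; apply/eqP; apply: eq_bigr => j _.
rewrite inE; case: (eqVneq j i) => [->|_]; first by rewrite iA.
by case: (_ && _).
Qed.

Lemma field_outer A s J i : i \in A -> local_field R (~: A)%SET s J i =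
  (total J (outer_edges A s i true))%:R - (total J (outer_edges A s i false))%:R.
Proof.
move=> iA; rewrite /total !natr_sum /local_field.
rewrite [X in _ = X - _]big_mkcond [X in _ = _ - X]big_mkcond -sumrB.
apply: eq_bigr => e _; rewrite !inE /coef !inE /spin.
have := edge_neq e; case: (val e) => a c /=.
case: (eqVneq a i) => [->|_]; case: (eqVneq c i) => [->|_] //= _; rewrite ?iA /=.
- by case: (c \in A); case: (s c); case: (J e) => /=; lra.
- by case: (a \in A); case: (s a); case: (J e) => /=; lra.
by rewrite !mul0r addr0 mulr0 subrr.
Qed.

Lemma Ex_field_outer A s i (phi : R -> R) : i \in A ->
  Ex p (fun J => phi (local_field R (~: A)%SET s J i)) =
  bin p #|[set j | (j \notin A) && (s j == true)]%SET| (fun k =>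
  bin p #|[set j | (j \notin A) && (s j == false)]%SET| (fun l => phi (k%:R - l%:R))).
Proof.
move=> iA.
rewrite -!(card_outer_edges s _ iA) -Ex_total2.
  by apply: eq_Ex => J; rewrite field_outer.
apply/pred0P => e; rewrite !inE; have := edge_neq e; case: (val e) => a c /=.
case: (eqVneq a i) => [->|_]; case: (eqVneq c i) => [->|_] //= _; rewrite ?andbF ?orbF //.
- by case: (s c); rewrite ?andbF.
- by case: (s a); rewrite ?andbF.
Qed.

(** Edges leaving [A] belong to a single vertex of [A], so the fields of the vertices of [A]
exerted from outside are independent. *)
Lemma pr_outer A s (x mu : R) : 0 < mu <= 1 ->
  (forall i, i \in A -> mu <= Ex p (fun J => Num.sg (local_field R (~: A)%SET s J i - x))) ->
  Pr p (fun J => (\sum_(i in A) Num.sg (local_field R (~: A)%SET s J i - x) <= #|A|%:R * mu / 2)%R)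
  <= expR (- (#|A|%:R * mu ^+ 2 / 32)).
Proof.
move=> /andP[mu0 mu1] hmu; pose l := mu / 8.
pose Z i J := Num.sg (local_field R (~: A)%SET s J i - x).
pose F J := expR (l * (#|A|%:R * mu / 2)) * \prod_(i <- enum A) expR (- (l * Z i J)).
have l0 : 0 < l by rewrite divr_gt0.
apply: (@le_trans _ _ (Ex p F)).
  apply: Pr_markov => // J.
    by rewrite mulr_ge0 ?expR_ge0 // prodr_ge0 // => i _; rewrite expR_ge0.
  move=> h; rewrite /F -expR_sum -expRD -[leLHS]expR0 ler_expR big_enum /= sumrN -mulr_sumr -mulrBr.
  by rewrite mulr_ge0 ?subr_ge0 // ltW.
rewrite /F ExZ (Ex_indep_prod p (D := fun i e => ((val e).1 == i) && ((val e).2 \notin A)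
   || ((val e).2 == i) && ((val e).1 \notin A))); last 3 first.
- exact: enum_uniq.
- move=> i; rewrite mem_enum => iA J J' h; congr (expR (- (l * Num.sg (_ - x)))).
  apply: eq_bigr => e _; rewrite /coef !inE.
  case: (boolP ((((val e).1 == i) && ((val e).2 \notin A) || ((val e).2 == i) && ((val e).1 \notin A)))).
    by move/h => ->.
  rewrite negb_or !negb_and; case: (_ == i) => /=; case: (_ == i) => //=;
   case: (_ \in A) => //=; case: (_ \in A) => //=; by rewrite !(mul0r, mulr0, addr0).
- move=> i j e; rewrite !mem_enum => iA jA.
  case/orP => /andP[/eqP ei hA]; case/orP => /andP[/eqP ej hA']; rewrite -?ei -?ej //.
  + by move: hA; rewrite ej jA.
  + by move: hA; rewrite ej jA.
rewrite big_enum /=.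
apply: (@le_trans _ _ (expR (l * (#|A|%:R * mu / 2)) * \prod_(i in A) expR (- (l * mu) + 2 * l ^+ 2))).
  rewrite ler_pM2l ?expR_gt0 //; apply: ler_prod => i iA; apply/andP; split.
    by rewrite -(Ex_cst p (edge N) 0); apply: le_Ex => // J; exact: expR_ge0.
  apply: le_trans (expR_ge1Dx _).
  apply: (@le_trans _ _ (Ex p (fun J => (1 + 2 * l ^+ 2) + (- l) * Z i J))).
    apply: le_Ex => // J; apply: le_trans (expR_le_quadratic _) _.
      have : -1 <= Z i J by rewrite /Z; case: sgrP => _; lra.
      move=> hZ; rewrite -mulrN; apply: (@le_trans _ _ (l * 1)); rewrite ?ler_pM2l //; rewrite /l; lra.
    have : Z i J ^+ 2 <= 1 by rewrite /Z; case: sgrP => _; rewrite ?expr2; lra.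
    rewrite sqrrN exprMn => hZ; have := ler_wpM2l (sqr_ge0 l) hZ; lra.
  rewrite ExD ExZ Ex_cst //; have := ler_wpM2l (ltW l0) (hmu i iA); rewrite -/(Z i).
  by set E := Ex p (Z i); rewrite -/E; lra.
rewrite prodr_const -expRM_natl -expRD ler_expR /l le_eqVlt; apply/orP; left; apply/eqP.
by rewrite -mulr_natr; field.
Qed.

End BlockEstimates.

(** * From blocks to whole configurations *)

Section Blocks.
Variable (N : nat).
Implicit Types (s : config N) (j : 'I_N) (m l : nat).

Lemma count_iota_divn m l n : (0 < m)%N -> (l.+1 * m <= n)%N ->
  count (fun k => k %/ m == l)%N (iota 0 n) = m.
Proof.
move=> m0 hn.
have -> : n = (l * m + (m + (n - l.+1 * m)))%N by lia.
rewrite iotaD count_cat iotaD count_cat add0n.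
rewrite (@eq_in_count _ _ pred0 (iota 0 _)) ?count_pred0; last first.
  move=> k; rewrite mem_iota /= add0n => hk; apply/negbTE.
  by rewrite neq_ltn ltn_divLR // hk.
rewrite (@eq_in_count _ _ predT (iota _ m)) ?count_predT ?size_iota; last first.
  move=> k; rewrite mem_iota /= => hk; apply/eqP/eqP.
  by rewrite eqn_leq leq_divRL // -ltnS ltn_divLR //; lia.
rewrite (@eq_in_count _ _ pred0 (iota _ (n - _))) ?count_pred0; last first.
  move=> k; rewrite mem_iota /= => hk; apply/negbTE.
  by rewrite neq_ltn leq_divRL //; apply/orP; right; lia.
by rewrite add0n addn0.
Qed.

Definition spin_class s (b : bool) : {set 'I_N} := [set j | s j == b]%SET.

Definition rank s j : nat := index j (enum (spin_class s (s j))).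

(** The [j]-th vertex of either spin class goes to block [j %/ m]; a block that is not
truncated by the end of a class therefore contains [m] vertices of each spin. *)
Definition block s m l : {set 'I_N} := [set j | (rank s j %/ m == l)%N]%SET.

Lemma card_block_class s m l b : (0 < m)%N -> (l.+1 * m <= #|spin_class s b|)%N ->
  #|(block s m l :&: spin_class s b)%SET| = m.
Proof.
move=> m0 hl; rewrite -[RHS](count_iota_divn m0 hl).
set e := enum (spin_class s b).
have -> : iota 0 #|spin_class s b| = [seq index j e | j <- e].
  rewrite cardE -/e; apply: (@eq_from_nth _ 0%N); first by rewrite size_iota size_map.
  move=> k; rewrite size_iota => hk.
  have [j0 _] : exists j0, j0 \in e by case: (e) hk => // j0 ? _; exists j0; rewrite mem_head.
  by rewrite nth_iota // (nth_map j0) // index_uniq // enum_uniq.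
rewrite count_map cardE -size_filter; apply/perm_size/uniq_perm.
- exact: enum_uniq.
- by apply: filter_uniq; exact: enum_uniq.
move=> j; rewrite [RHS]mem_filter /e !mem_enum !inE /= andbC /rank.
by case: (eqVneq (s j) b) => [<-|_] /=; rewrite ?andbT ?andbF.
Qed.

Lemma setI_classes (A : {set 'I_N}) s :
  A = ((A :&: spin_class s true) :|: (A :&: spin_class s false))%SET.
Proof. by apply/setP => j; rewrite !inE; case: (s j); rewrite ?andbT ?andbF ?orbF. Qed.

Lemma disjoint_classes (A : {set 'I_N}) s :
  [disjoint (A :&: spin_class s true)%SET & (A :&: spin_class s false)%SET].
Proof. by apply/pred0P => j; rewrite /= !inE; case: (s j); rewrite ?andbF. Qed.

Lemma sum_spin (R : realType) (A : {set 'I_N}) s : \sum_(j in A) spin R (s j) =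
  #|(A :&: spin_class s true)%SET|%:R - #|(A :&: spin_class s false)%SET|%:R.
Proof.
rewrite (eq_bigl [predU (A :&: spin_class s true)%SET & (A :&: spin_class s false)%SET]); last first.
  by move=> j; rewrite {1}(setI_classes A s) !inE.
rewrite bigU ?disjoint_classes //=.
rewrite (eq_bigr (fun=> 1)); last by move=> j; rewrite !inE => /andP[_ /eqP ->].
rewrite [X in _ + X](eq_bigr (fun=> -1)); last by move=> j; rewrite !inE => /andP[_ /eqP ->].
by rewrite !sumr_const -mulNrn.
Qed.

Section BlockFacts.
Variables (s : config N) (m : nat).
Hypotheses (m0 : (0 < m)%N) (hs : (#|spin_class s false| <= #|spin_class s true|)%N).
Let L := (#|spin_class s false| %/ m)%N.

Let hL b l : (l < L)%N -> (l.+1 * m <= #|spin_class s b|)%N.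
Proof.
move=> hl; have h : (l.+1 * m <= #|spin_class s false|)%N.
  by apply: (leq_trans (leq_mul hl (leqnn m))); rewrite leq_divM.
by case: b => //; apply: leq_trans h hs.
Qed.

Lemma card_block l : (l < L)%N -> #|block s m l| = (2 * m)%N.
Proof.
move=> hl; rewrite (setI_classes (block s m l) s) cardsU.
by rewrite !card_block_class ?hL // (disjoint_setI0 (disjoint_classes _ _)) cards0; lia.
Qed.

Lemma block_balanced (R : realType) l : (l < L)%N -> \sum_(j in block s m l) spin R (s j) = 0.
Proof. by move=> hl; rewrite sum_spin !card_block_class ?hL // subrr. Qed.

End BlockFacts.

(** The vertices outside the [L] blocks can lower the sum by at most 1 each. *)
Lemma sum_blocks (R : realType) s m L (f : 'I_N -> R) : (forall i, -1 <= f i) ->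
  (forall l, (l < L)%N -> #|block s m l| = (2 * m)%N) ->
  \sum_(l < L) \sum_(i in block s m l) f i - (N%:R - (L * (2 * m))%:R) <= \sum_i f i.
Proof.
move=> hf hc.
have h : \sum_(l < L) \sum_(i in block s m l) (f i + 1) <= \sum_i (f i + 1).
  under eq_bigr do rewrite big_mkcond.
  rewrite exchange_big /=; apply: ler_sum => i _.
  have fi : 0 <= f i + 1 by have := hf i; lra.
  case: (ltnP (rank s i %/ m)%N L) => hl.
    rewrite (bigD1 (Ordinal hl)) //= inE eqxx big1 ?addr0 // => l.
    by rewrite -val_eqE /= inE eq_sym => /negbTE ->.
  rewrite big1 // => l _; rewrite inE; case: eqP => // e.
  by have := ltn_ord l; rewrite -e ltnNge hl.
move: h; rewrite big_split /= sumr_const card_ord.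
under eq_bigr do rewrite big_split /= sumr_const.
rewrite big_split /=; rewrite [X in _ + X <= _](eq_bigr (fun=> (2 * m)%:R)); last first.
  by move=> l _; rewrite hc.
rewrite sumr_const card_ord -[_ *+ L]mulr_natl -natrM; lra.
Qed.

End Blocks.

Section ConfigEstimate.
Variables (R : realType) (p : R) (N : nat).
Hypotheses (hp0 : 0 < p) (hp1 : p <= 1).
Implicit Types (A B : {set 'I_N}) (s : config N) (J : couplings N) (i j : 'I_N).

(** As the block [A] is balanced, the plus spins outside [A] outnumber the minus spins outside
[A] by the full magnetization [M]. *)
Lemma outer_bias A s i (M n0 : nat) (x w : R) :
  \sum_(j in A) spin R (s j) = 0 -> \sum_j spin R (s j) = M%:R -> i \in A ->
  0 < x -> 0 < w -> N%:R <= w ^+ 2 / 2 -> 2 * w <= n0%:R * x -> 4 * x <= p * M%:R ->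
  (4 * n0%:R)^-1 - 8 / (p ^+ 2 * M%:R)
  <= Ex p (fun J => Num.sg (local_field R (~: A)%SET s J i - x)).
Proof.
move=> hbal hM iA x0 w0 hw hn0 hx.
rewrite (Ex_field_outer p s (fun y => Num.sg (y - x)) iA).
set q := #|[set j | (j \notin A) && (s j == false)]%SET|.
have -> : #|[set j | (j \notin A) && (s j == true)]%SET| = (q + M)%N.
  apply/eqP; rewrite -(eqr_nat R) natrD -hM addrC -subr_eq; apply/eqP.
  rewrite (bigID (mem A)) /= hbal add0r (eq_bigl (mem (~: A)%SET)); last by move=> j; rewrite /= !inE.
  rewrite sum_spin; congr (_%:R - _%:R); apply: eq_card => j; by rewrite !inE.
apply: (bin_sgr_bias hp0 hp1 x0 w0) => //; apply: le_trans hw.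
by rewrite ler_nat -[leqRHS]card_ord max_card.
Qed.

(** If the inner field at [i] is at least [- x], the sign of the total field is at least that of the
outer field minus [x]; otherwise replacing one by the other loses at most 2. *)
Lemma pr_block A s (x mu : R) : (0 < #|A|)%N -> \sum_(j in A) spin R (s j) = 0 ->
  2 <= x -> 0 < mu <= 1 ->
  (forall i, i \in A -> mu <= Ex p (fun J => Num.sg (local_field R (~: A)%SET s J i - x))) ->
  Pr p (fun J => (\sum_(i in A) Num.sg (local_field R [set: 'I_N]%SET s J i) <= #|A|%:R * mu / 4)%R)
  <= 2 ^+ #|A| * expR (- ((x * mu) ^+ 2 / 8192)) + expR (- (#|A|%:R * mu ^+ 2 / 32)).
Proof.
move=> A0 hbal x2 hmu hE; have /andP[mu0 mu1] := hmu.
have a0 : 0 < #|A|%:R :> R by rewrite ltr0n.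
set a := #|A|%:R : R in a0 *.
have k0 : 0 <= a * mu / 8 by rewrite divr_ge0 // mulr_ge0 ?ltW.
have := pr_inner hp0 hp1 hbal A0 x2 k0; have := pr_outer hp0 hp1 hmu hE.
rewrite -/a (_ : (a * mu / 8 * x / 2) ^+ 2 / (32 * a ^+ 2) = (x * mu) ^+ 2 / 8192); last first.
  by field; lra.
move=> h1 h2; apply: le_trans (lerD h2 h1) => {h1 h2}; apply: le_trans (Pr_or hp0 hp1 _ _).
apply: le_Pr => // J; apply: contraLR; rewrite negb_or -!ltNge => /andP[hk hZ].
set bad := [set i in A | _]%SET in hk.
have : \sum_(i in A) (Num.sg (local_field R (~: A)%SET s J i - x) - 2 * (i \in bad)%:R)
   <= \sum_(i in A) Num.sg (local_field R [set: 'I_N]%SET s J i).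
  apply: ler_sum => i iA; rewrite (field_split R A) inE iA /=; case: ltrP => hi.
    have [_ b1] := sgr_bounds (local_field R (~: A)%SET s J i - x).
    have [b2 _] := sgr_bounds (local_field R A s J i + local_field R (~: A)%SET s J i).
    by rewrite mulr1; lra.
  by rewrite mulr0 subr0; apply: le_sgr; lra.
rewrite sumrB -mulr_sumr (_ : \sum_(i in A) (i \in bad)%:R = #|bad|%:R); last first.
  rewrite -sum_mem [RHS](bigID (mem A)) /= [X in _ + X]big1 ?addr0 // => i.
  by rewrite inE => /negbTE ->.
lra.
Qed.

Lemma pr_config s (m M n0 : nat) (x w mu : R) :
  (0 < m)%N -> \sum_j spin R (s j) = M%:R -> 2 <= x -> 0 < mu <= 1 ->
  0 < w -> N%:R <= w ^+ 2 / 2 -> 2 * w <= n0%:R * x -> 4 * x <= p * M%:R ->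
  mu <= (4 * n0%:R)^-1 - 8 / (p ^+ 2 * M%:R) ->
  Pr p (fun J => (\sum_i Num.sg (local_field R [set: 'I_N]%SET s J i)
     < (N%:R - M%:R - 2 * m%:R) * (mu / 4) - (M%:R + 2 * m%:R))%R)
  <= N%:R * (2 ^+ (2 * m) * expR (- ((x * mu) ^+ 2 / 8192)) + expR (- ((2 * m)%:R * mu ^+ 2 / 32))).
Proof.
move=> m0 hM x2 hmu w0 hw hn0 hx hmuE; have /andP[mu0 mu1] := hmu.
have hPQ : #|spin_class s true|%:R - #|spin_class s false|%:R = M%:R :> R.
  rewrite -hM (_ : \sum_j spin R (s j) = \sum_(j in [set: 'I_N]%SET) spin R (s j)).
    by rewrite sum_spin !finset.setTI.
  by apply: eq_bigl => j; rewrite inE.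
have hPQ' : #|spin_class s true|%:R + #|spin_class s false|%:R = N%:R :> R.
  rewrite -natrD -[in RHS](card_ord N) -cardsT (setI_classes [set: 'I_N]%SET s) cardsU.
  by rewrite (disjoint_setI0 (disjoint_classes _ _)) cards0 subn0 !finset.setTI.
have hs : (#|spin_class s false| <= #|spin_class s true|)%N.
  by rewrite -(ler_nat R); have : 0 <= M%:R :> R by []; lra.
set L := (#|spin_class s false| %/ m)%N.
have LN : (L <= N)%N.
  by apply: (leq_trans (leq_div _ _)); rewrite -[leqRHS]card_ord max_card.
have hL : #|spin_class s false|%:R <= L%:R * m%:R + m%:R :> R.
  rewrite -natrM -natrD ler_nat [leqLHS](divn_eq _ m) leq_add2l ltnW // ltn_pmod //.
set rhs := 2 ^+ _ * _ + _.
have rhs0 : 0 <= rhs.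
  by apply: addr_ge0; [apply: mulr_ge0; [exact: exprn_ge0|exact: expR_ge0]|exact: expR_ge0].
pose E (l : 'I_L) J : bool := (\sum_(i in block s m l) Num.sg (local_field R [set: 'I_N]%SET s J i)
   <= #|block s m l|%:R * mu / 4)%R.
apply: (@le_trans _ _ (#|'I_L|%:R * rhs)); last first.
  by rewrite card_ord ler_wpM2r // ler_nat.
apply: le_trans (Pr_union hp0 hp1 (A := E) (B := predT) (c := rhs) _); last first.
  move=> l _; rewrite /rhs -(card_block m0 hs (ltn_ord l)); apply: pr_block => //.
  - by rewrite (card_block m0 hs (ltn_ord l)) muln_gt0.
  - exact: (block_balanced m0 hs R (ltn_ord l)).
  - move=> i iA; apply: le_trans hmuE _; apply: outer_bias hw hn0 hx => //; last by lra.
    exact: (block_balanced m0 hs R (ltn_ord l)).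
apply: le_Pr => // J; apply: contraLR => /existsPn hno; rewrite -leNgt.
have hb l : (l < L)%N -> #|block s m l| = (2 * m)%N by exact: card_block.
have hsg i : -1 <= Num.sg (local_field R [set: 'I_N]%SET s J i) := proj1 (sgr_bounds _).
apply: le_trans (sum_blocks hsg hb).
have : \sum_(l < L) (2 * m)%:R * mu / 4 <=
   \sum_(l < L) \sum_(i in block s m l) Num.sg (local_field R [set: 'I_N]%SET s J i).
  apply: ler_sum => l _; have := hno l; rewrite /E -ltNge hb ?ltn_ord // => /ltW.
  exact.
rewrite sumr_const card_ord -mulr_natl !natrM.
set S := \sum_(l < L) _ => hS.
have h1 : N%:R - M%:R - 2 * m%:R <= L%:R * (2 * m%:R) :> R by lra.
have mu4 : 0 <= mu / 4 by lra.
have h2 := ler_wpM2r mu4 h1; clear - h1 h2 hS; lra.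
Qed.

End ConfigEstimate.

(** * Typical graphs *)

Section GoodCouplings.
Variables (R : realType) (p : R) (N : nat) (u : R).
Hypotheses (hp0 : 0 < p) (hp1 : p <= 1).
Hypotheses (hu1 : 1 <= u) (hN : N%:R = u ^+ 20).
Implicit Types (A B : {set 'I_N}) (s : config N) (J : couplings N) (i j : 'I_N).

Local Notation h := (local_field R [set: 'I_N]%SET).
Local Notation mag := (magnetization R).

Definition pull s J : R := \sum_i Num.sg (h s J i) - mag s.

Lemma leXu (i j : nat) : (i <= j)%N -> u ^+ i <= u ^+ j.
Proof. exact: ler_weXn2l. Qed.

Lemma dominate (c : R) (i j : nat) : c <= u -> (i < j)%N -> c * u ^+ i <= u ^+ j.
Proof.
move=> cu ij; apply: le_trans (leXu ij); rewrite exprS ler_wpM2r // exprn_ge0 //.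
exact: le_trans ler01 hu1.
Qed.

Lemma u_gt0 : 0 < u. Proof. exact: lt_le_trans ltr01 hu1. Qed.

Lemma u_pow_ge1 k : 1 <= u ^+ k. Proof. by rewrite -(expr0 u); exact: leXu. Qed.

Lemma N_gt0 : (0 < N)%N. Proof. by rewrite -(ltr0n R) hN exprn_gt0 ?u_gt0. Qed.

Local Hint Resolve u_gt0 u_pow_ge1 N_gt0 : core.

Definition discrepancy J : bool := [forall B : {set 'I_N}, forall s : config N,
  (p * (\sum_(i in B) \sum_(j in [set: 'I_N]%SET | j != i) spin R (s j)) - 12 * u ^+ 30
   < \sum_(i in B) h s J i)%R].

Lemma pr_discrepancy : Pr p (fun J => ~~ discrepancy J) <= expR (- u).
Proof.
pose E (Bs : {set 'I_N} * config N) J : bool := (\sum_(i in Bs.1) h Bs.2 J i <=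
  p * (\sum_(i in Bs.1) \sum_(j in [set: 'I_N]%SET | j != i) spin R (Bs.2 j)) - 12 * u ^+ 30)%R.
apply: (@le_trans _ _ (Pr p (fun J => [exists Bs, predT Bs && E Bs J]))).
  apply: le_Pr => // J; rewrite negb_forall => /existsP[B]; rewrite negb_forall => /existsP[s].
  by rewrite -leNgt => hJ; apply/existsP; exists (B, s).
have cN : #|[set: 'I_N]%SET| = N by rewrite cardsT card_ord.
apply: (le_trans (Pr_union hp0 hp1 (c := expR (- (9 / 2 * N%:R))) _)).
  move=> [B s] _; apply: le_trans (field_hoeffding hp0 hp1 s _ _ _) _.
  - exact: finset.subsetT.
  - by rewrite cN.
  - by rewrite mulr_ge0 // exprn_ge0 // ltW.
  rewrite cN hN ler_expR le_eqVlt; apply/orP; left; apply/eqP; field.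
  exact: lt0r_neq0.
have cS : #|{: {set 'I_N}}| = (2 ^ N)%N by rewrite -cardsT -powersetT card_powerset cardsT card_ord.
rewrite cardT -cardE card_prod cS card_ffun card_bool card_ord -expnD addnn -mul2n.
rewrite natrX; apply: le_trans (ler_wpM2r (expR_ge0 _) (expR_2pow R _)) _.
rewrite -expRD ler_expR natrM hN.
have := leXu (isT : 1 <= 20)%N; rewrite expr1; have := u_pow_ge1 20; lra.
Qed.

Lemma sum_neq s i : \sum_(j in [set: 'I_N]%SET | j != i) spin R (s j) = mag s - spin R (s i).
Proof.
rewrite magnetizationE [X in _ = X - _](bigD1 i) //= addrAC subrr add0r.
by apply: eq_bigl => j; rewrite !inE.
Qed.

(** For [B] the set of vertices with a nonpositive field, [discrepancy] gives
[p #|B| (M - 1) < 12 N ^ (3/2)], hence [#|B| < p N / 16]. *)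
Lemma discrepancy_pull J s : discrepancy J -> 384 / p ^+ 2 * u ^+ 10 <= mag s ->
  mag s <= (1 - p / 4) * N%:R -> p / 8 * N%:R <= pull s J.
Proof.
move=> /forallP /(_ [set i | (h s J i <= 0)%R]%SET) /forallP /(_ s).
set B := [set i | _]%SET => hB hM hT.
have [k hk] : exists k : R, k = #|B|%:R by exists #|B|%:R.
have p2 : 0 < p ^+ 2 by rewrite exprn_gt0.
have h1 : \sum_(i in B) h s J i <= 0.
  by apply: sumr_le0 => i; rewrite inE.
have h2 : k * (mag s - 1) <= \sum_(i in B) \sum_(j in [set: 'I_N]%SET | j != i) spin R (s j).
  rewrite hk mulr_natl -sumr_const; apply: ler_sum => i _; rewrite sum_neq lerD2l lerN2.
  by rewrite /spin; case: (s i); lra.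
set S := \sum_(i in B) \sum_(j in _ | _) _ in hB h2.
have h3 : 384 * u ^+ 10 <= p ^+ 2 * mag s.
  have -> : 384 * u ^+ 10 = p ^+ 2 * (384 / p ^+ 2 * u ^+ 10) by field; exact: lt0r_neq0.
  by rewrite ler_pM2l.
have pp : p ^+ 2 <= 1 by rewrite exprn_ile1 // ltW.
have m1 : 0 <= mag s.
  by apply: le_trans hM; exact: mulr_ge0 (divr_ge0 (ler0n _ _) (ltW p2)) (exprn_ge0 _ (ltW u_gt0)).
have h4 : 2 <= mag s.
  have := ler_wpM2r m1 pp; have := u_pow_ge1 10; clear - hp0 hp1 hu1 hN h3; lra.
have k0 : 0 <= k by rewrite hk ler0n.
have h5 : p * (k * (mag s / 2)) < 12 * u ^+ 30.
  apply: (@le_lt_trans _ _ (p * S)); last by clear - hp0 hp1 hu1 hN hB h1; lra.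
  rewrite ler_wpM2l //; first exact: ltW.
  by apply: le_trans h2; rewrite ler_wpM2l //; clear - hp0 hp1 hu1 hN h4; lra.
have h6 : k * (384 * u ^+ 10) < p * 24 * u ^+ 30.
  have a1 : k * (384 * u ^+ 10) <= k * (p ^+ 2 * mag s) by rewrite ler_wpM2l.
  have a2 : p * (p * (k * (mag s / 2))) < p * (12 * u ^+ 30) by rewrite ltr_pM2l.
  by rewrite expr2 in a1; clear - hp0 hp1 hu1 hN a1 a2; lra.
have h7 : k < p / 16 * N%:R.
  rewrite hN -(ltr_pM2r (_ : 0 < 384 * u ^+ 10)); last exact: mulr_gt0 (ltr0Sn _ _) (exprn_gt0 _ u_gt0).
  by have -> : p / 16 * u ^+ 20 * (384 * u ^+ 10) = p * 24 * u ^+ 30 by field.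
have h8 : \sum_i (1 - 2 * (i \in B)%:R) <= \sum_i Num.sg (h s J i).
  by apply: ler_sum => i _; rewrite inE; case: sgrP => _; rewrite /=; lra.
rewrite sumrB sumr_const card_ord -mulr_sumr sum_mem -hk in h8.
by rewrite /pull; clear - hp0 hp1 hu1 hN h8 h7 hT; lra.
Qed.

Definition rich J : bool := [forall i, (p * N%:R / 2 < h [ffun=> true] J i)%R].

Lemma pr_rich : 42 * 128 / p ^+ 2 <= u -> Pr p (fun J => ~~ rich J) <= expR (- u).
Proof.
move=> hu; have p2 : 0 < p ^+ 2 by rewrite exprn_gt0.
have hu' : 42 * 128 <= u * p ^+ 2 by rewrite -ler_pdivrMr.
have pp : p ^+ 2 <= 1 by rewrite exprn_ile1 // ltW.
have u4 : 4 <= u by have := ler_wpM2l (ltW u_gt0) pp; lra.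
have N4 : 4 <= N%:R :> R.
  by rewrite hN; have := leXu (isT : 1 <= 20)%N; rewrite expr1; clear - hp0 hp1 hu1 hN u4; lra.
pose E i J : bool := (h [ffun=> true] J i <=
  \sum_e p * coef R [set: 'I_N]%SET [ffun=> true] i e - p * N%:R / 4)%R.
apply: (@le_trans _ _ (Pr p (fun J => [exists i, predT i && E i J]))).
  apply: le_Pr => // J; rewrite negb_forall => /existsP[i]; rewrite -leNgt => hJ.
  apply/existsP; exists i; rewrite /= /E; apply: (le_trans hJ).
  rewrite -mulr_sumr sum_coef sum_neq magnetizationE.
  rewrite (eq_bigr (fun=> 1)); last by move=> j _; rewrite ffunE.
  rewrite sumr_const card_ord ffunE /spin.
  by have := ler_wpM2l (ltW hp0) N4; clear - hp0 hp1 hu1 hN; lra.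
apply: (le_trans (Pr_union hp0 hp1 (c := expR (- (p ^+ 2 * N%:R / 128))) _)).
  move=> i _; have NR : 0 < N%:R :> R by rewrite ltr0n.
  apply: le_trans (Pr_hoeffding hp0 hp1 _ NR _) _.
  - by apply: divr_ge0 => //; apply: mulr_ge0; exact: ltW.
  - apply: (@le_trans _ _ (\sum_(e : edge N) (((val e).1 == i)%:R * 1 + ((val e).2 == i)%:R * 1))).
      apply: ler_sum => e _; rewrite /coef !inE !ffunE /spin.
      have := edge_neq e; case: (val e) => a c /=.
      by clear - hp0 hp1 hu1 hN; case: (eqVneq a i) => [->|_]; case: (eqVneq c i) => _ //= _;
        rewrite ?expr2; lra.
    rewrite (sum_edges_at i (fun=> 1)) sumr_const ler_nat -[leqRHS]card_ord.
    exact: max_card.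
  rewrite ler_expR le_eqVlt; apply/orP; left; apply/eqP; field.
  exact: lt0r_neq0.
rewrite cardT size_enum_ord hN.
apply: (@le_trans _ _ (expR u ^+ 20 * expR (- (p ^+ 2 * u ^+ 20 / 128)))).
  rewrite ler_pM2r ?expR_gt0 //; apply: lerXn2r; rewrite ?nnegrE ?expR_ge0 // ?ltW //.
  by have := expR_ge1Dx u; clear - hp0 hp1 hu1 hN; lra.
rewrite -expRM_natl -expRD ler_expR.
have hd : 42 * 128 / p ^+ 2 * u ^+ 1 <= u ^+ 20 by exact: dominate.
rewrite expr1 mulrAC ler_pdivrMr // in hd.
by clear - hp0 hp1 hu1 hN hd u4; lra.
Qed.

(** Turning a spin from plus to minus lowers the field at another vertex by at most 2, so the field
is at least the degree minus [N - M]. *)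
Lemma rich_field J s i : rich J -> (1 - p / 4) * N%:R <= mag s -> 0 < h s J i.
Proof.
move=> /forallP /(_ i) hi hM.
have pN : 0 < p * N%:R by rewrite mulr_gt0 // ltr0n.
suff hs : h [ffun=> true] J i - h s J i <= N%:R - mag s by clear - hp0 hp1 hu1 hN pN hi hM hs; lra.
rewrite /local_field -sumrB.
apply: (@le_trans _ _ (\sum_(j | j != i) (1 - spin R (s j)))).
  rewrite -(sum_edges_at i (fun j => 1 - spin R (s j))); apply: ler_sum => e _.
  rewrite /coef !inE !ffunE -mulrBr /spin; clear - hp0 hp1 hu1 hN; case: (_ == i); case: (_ == i);
   case: (s _); case: (s _); case: (J e); rewrite /=; lra.
have -> : N%:R = \sum_(j < N) 1 :> R by rewrite sumr_const card_ord.
rewrite magnetizationE -sumrB big_mkcond.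
apply: ler_sum => j _; case: ifP => // _; rewrite /spin; case: (s j); clear - hp0 hp1 hu1 hN; lra.
Qed.

Fixpoint reach (x0 : config N) (t : nat) : {set config N} :=
  if t is t'.+1 then
    (reach x0 t' :|: [set flip si.2 si.1 | si in finset.setX (reach x0 t') [set: 'I_N]])%SET
  else [set x0]%SET.

Lemma card_reach x0 t : (#|reach x0 t| <= N.+1 ^ t)%N.
Proof.
elim: t => [|t IH] /=; first by rewrite cards1.
apply: (leq_trans (leq_card_setU _ _)).
apply: (leq_trans (leq_add (leqnn _) (leq_imset_card _ _))).
by rewrite cardsX cardsT card_ord expnSr -mulnS leq_mul2r IH orbT.
Qed.

(** For large [u], a lower bound for the mean sign of an outer field lowered by the threshold
[x = p u ^ 9 / 8], at magnetizations of at least [u ^ 9 / 2]. *)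
Definition mu : R := p / (300 * u).

Definition early x0 T J : bool := [forall s, (s \in reach x0 T) ==>
  ((u ^+ 9 / 2 <= mag s)%R ==> (mag s <= 384 / p ^+ 2 * u ^+ 10)%R
   ==> (mu / 16 * N%:R <= pull s J)%R)].

Lemma magnetization_nat s : 0 <= mag s -> exists M : nat, mag s = M%:R.
Proof.
rewrite magnetizationE (_ : \sum_j spin R (s j) = \sum_(j in [set: 'I_N]%SET) spin R (s j)); last first.
  by apply: eq_bigl => j; rewrite inE.
rewrite sum_spin; set a := #|_|; set b := #|_|; rewrite subr_ge0 ler_nat => ba.
by exists (a - b)%N; rewrite natrB.
Qed.

(** [pr_config] with blocks of [2 m] vertices, [m] about [u ^ 15], and threshold [x] of order
[u ^ 9]. The block must be small enough for [x] to exceed the typical inner field, of order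
[sqrt m], by a factor that pays for the union bound over its subsets, and large enough for the
outer fields to give a bound beating the number of configurations to be considered. *)
Lemma pr_early_config s (hu2 : 16 / p <= u) (hu3 : 4000 / p ^+ 3 <= u)
  (hu4 : 12800 * 384 / p ^+ 3 <= u) (hu5 : 12800 / p <= u) :
  u ^+ 9 / 2 <= mag s -> mag s <= 384 / p ^+ 2 * u ^+ 10 ->
  Pr p (fun J => (pull s J < mu / 16 * N%:R)%R) <=
  N%:R * (expR (2 * u ^+ 15 - (p ^+ 2 * u ^+ 8 / 2400) ^+ 2 / 8192)
          + expR (- (p ^+ 2 * u ^+ 13 / (300 ^+ 2 * 32)))).
Proof.
move=> hM1 hM2; have pu : 0 < p ^+ 2 by rewrite exprn_gt0.
have p3 : 0 < p ^+ 3 by rewrite exprn_gt0.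
have [M hM] : exists M : nat, mag s = M%:R.
  by apply: magnetization_nat; have := u_pow_ge1 9; clear - hp0 hp1 hu1 hN hM1; lra.
rewrite hM in hM1 hM2.
have [m hm] : exists m, m = Num.truncn (u ^+ 15) by exists (Num.truncn (u ^+ 15)).
have := truncn_itv (ltW (exprn_gt0 15 u_gt0)); rewrite -hm => /andP[m1 m2].
rewrite -natr1 in m2.
have m0 : (0 < m)%N by rewrite hm truncn_gt0.
have mR : 1 <= m%:R :> R by rewrite ler1n.
have hn : 0 <= 32 * u / p by rewrite divr_ge0 ?mulr_ge0 // ltW.
have [n0 hn0] : exists n0, n0 = (Num.truncn (32 * u / p)).+1 by exists (Num.truncn (32 * u / p)).+1.
have := truncn_itv hn; rewrite -hn0 => /andP[n1 n2].
have n3 : n0%:R <= 33 * u / p.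
  rewrite hn0 -natr1.
  have : 1 <= u / p by rewrite ler_pdivlMr // mul1r (le_trans hp1).
  by clear - hp0 hp1 hu1 hN n1; lra.
have n00 : 0 < n0%:R :> R by exact: le_lt_trans hn n2.
have u300 : 0 < 300 * u by exact: mulr_gt0 (ltr0Sn _ _) u_gt0.
have mu0 : 0 < mu by exact: divr_gt0 hp0 u300.
have mu1 : mu <= 1.
  rewrite /mu ler_pdivrMr //; by have := hp1; have := hu1; clear - hp0 hp1 hu1 hN; lra.
have [x hx] : exists x, x = p * u ^+ 9 / 8 by exists (p * u ^+ 9 / 8).
have x2 : 2 <= x.
  have hd : 16 / p * u ^+ 0 <= u ^+ 9 by exact: dominate.
  rewrite expr0 mulr1 ler_pdivrMr // in hd.
  by rewrite hx; clear - hp0 hp1 hu1 hN hd; lra.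
have u9 : 0 < u ^+ 9 by exact: exprn_gt0.
have M0 : 0 < M%:R :> R by clear - hp0 hp1 hu1 hN hM1 u9; lra.
have bias : mu <= (4 * n0%:R)^-1 - 8 / (p ^+ 2 * M%:R).
  have b1 : p / u / 132 <= (4 * n0%:R)^-1.
    rewrite -[leLHS]invrK lef_pV2; last 2 first.
    - by rewrite posrE invr_gt0 !divr_gt0.
    - by rewrite posrE mulr_gt0.
    apply: (@le_trans _ _ (4 * (33 * u / p))); first by rewrite ler_pM2l.
    rewrite le_eqVlt; apply/orP; left; apply/eqP; field; rewrite !lt0r_neq0 //.
  have b2 : 8 / (p ^+ 2 * M%:R) <= 8 * 2 / (p ^+ 2 * u ^+ 9).
    rewrite -mulrA ler_pM2l // -invf_div lef_pV2 ?posrE; last 2 first.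
    - by rewrite mulr_gt0.
    - by rewrite divr_gt0 // mulr_gt0.
    by rewrite -mulrA ler_pM2l.
  have b3 : 8 * 2 / (p ^+ 2 * u ^+ 9) <= p / u * (16 / 4000).
    have hd : 4000 / p ^+ 3 * u ^+ 0 <= u ^+ 8 by exact: dominate.
    rewrite expr0 mulr1 ler_pdivrMr // in hd.
    rewrite ler_pdivrMr; last by rewrite mulr_gt0.
    have -> : p / u * (16 / 4000) * (p ^+ 2 * u ^+ 9) = 16 / 4000 * (u ^+ 8 * p ^+ 3).
      by field; rewrite !lt0r_neq0.
    by clear - hp0 hp1 hu1 hN hd; lra.
  have pu0 : 0 < p / u by rewrite divr_gt0.
  have -> : mu = p / u / 300 by rewrite /mu; field; rewrite !lt0r_neq0.
  by clear - hp0 hp1 hu1 hN b1 b2 b3 pu0; lra.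
have hw : N%:R <= (2 * u ^+ 10) ^+ 2 / 2.
  rewrite hN le_eqVlt exprMn -exprM; apply/orP; right.
  by have := exprn_gt0 20 u_gt0; clear - hp0 hp1 hu1 hN; lra.
have hn0x : 2 * (2 * u ^+ 10) <= n0%:R * x.
  have := ler_wpM2r (_ : 0 <= x) (ltW n2); rewrite hx => hh.
  have e : 32 * u / p * (p * u ^+ 9 / 8) = 2 * (2 * u ^+ 10).
    by field; exact: lt0r_neq0.
  rewrite -e; apply: hh; rewrite -hx; clear - hp0 hp1 hu1 hN x2; lra.
have hxM : 4 * x <= p * M%:R.
  by have := ler_wpM2l (ltW hp0) hM1; rewrite hx; clear - hp0 hp1 hu1 hN; lra.
have x0 : 0 < x by clear - hp0 hp1 hu1 hN x2; lra.
have w0 : 0 < 2 * u ^+ 10 by rewrite mulr_gt0 // exprn_gt0.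
have hmag : \sum_j spin R (s j) = M%:R by rewrite -magnetizationE.
have mu01 : 0 < mu <= 1 by rewrite mu0 mu1.
have hmain := pr_config hp0 hp1 m0 hmag x2 mu01 w0 hw hn0x hxM bias.
have hmu : mu * u = p / 300 by rewrite /mu; field; exact: lt0r_neq0.
have step1 : mu / 16 * N%:R + M%:R <=
   (N%:R - M%:R - 2 * m%:R) * (mu / 4) - (M%:R + 2 * m%:R).
  have d1 : 12800 * 384 / p ^+ 3 * u ^+ 10 <= u ^+ 19 by exact: dominate.
  have d2 : 12800 / p * u ^+ 15 <= u ^+ 19 by exact: dominate.
  have [c hc] : exists c : R, c = 12800 by exists 12800.
  rewrite -hc in d1 d2.
  have c0 : 0 < c by rewrite hc ltr0n.
  have e1 : c * M%:R <= p * u ^+ 19.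
    apply: le_trans (ler_wpM2l (ltW c0) hM2) _; apply: le_trans (ler_wpM2l (ltW hp0) d1).
    by rewrite le_eqVlt; apply/orP; left; apply/eqP; field; exact: lt0r_neq0.
  have e2 : c * m%:R <= p * u ^+ 19.
    apply: le_trans (ler_wpM2l (ltW c0) m1) _; apply: le_trans (ler_wpM2l (ltW hp0) d2).
    by rewrite le_eqVlt; apply/orP; left; apply/eqP; field; exact: lt0r_neq0.
  rewrite hc in e1 e2.
  have e3 : mu * N%:R = p / 300 * u ^+ 19 by rewrite hN (exprS u 19) mulrA hmu.
  have e4 : M%:R * mu <= M%:R by rewrite ler_piMr // ltW.
  have e5 : m%:R * mu <= m%:R by rewrite ler_piMr // ler0n.
  have : 0 <= m%:R :> R by rewrite ler0n.
  clear - hp0 hp1 hu1 hN e1 e2 e3 e4 e5; lra.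
have step2 : 2 ^+ (2 * m) <= expR (2 * u ^+ 15) :> R.
  apply: (le_trans (expR_2pow R _)); rewrite ler_expR natrM; clear - hp0 hp1 hu1 hN m1; lra.
have step3 : (x * mu) ^+ 2 / 8192 = (p ^+ 2 * u ^+ 8 / 2400) ^+ 2 / 8192.
  by congr (_ ^+ 2 / _); rewrite hx /mu; field; exact: lt0r_neq0.
have step4 : p ^+ 2 * u ^+ 13 / (300 ^+ 2 * 32) <= (2 * m)%:R * mu ^+ 2 / 32.
  have -> : p ^+ 2 * u ^+ 13 / (300 ^+ 2 * 32) = u ^+ 15 * mu ^+ 2 / 32.
    by rewrite /mu; field; exact: lt0r_neq0.
  rewrite ler_pM2r; last by rewrite invr_gt0 ltr0n.
  apply: ler_wpM2r; first exact: sqr_ge0.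
  by rewrite natrM; clear - hp0 hp1 hu1 hN m2 mR; lra.
apply: (@le_trans _ _ (Pr p (fun J => (\sum_i Num.sg (h s J i)
     < (N%:R - M%:R - 2 * m%:R) * (mu / 4) - (M%:R + 2 * m%:R))%R))).
  apply: le_Pr => // J; rewrite /pull hM => hJ; clear - hp0 hp1 hu1 hN hJ step1; lra.
apply: (le_trans hmain); apply: ler_wpM2l; first exact: ler0n.
apply: lerD; last by rewrite ler_expR lerN2.
rewrite step3 expRD; apply: (ler_wpM2r (expR_ge0 _)); exact: step2.
Qed.

(** There are at most [(N + 1) ^ T = exp (O (u ^ 12))] configurations to consider. *)
Lemma pr_early x0 T (c c1 c2 : R) : 16 / p <= u -> 4000 / p ^+ 3 <= u ->
  12800 * 384 / p ^+ 3 <= u -> 12800 / p <= u -> T%:R <= c * u ^+ 11 -> 0 <= c ->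
  c1 = (p ^+ 2 / 2400) ^+ 2 / 8192 -> c2 = p ^+ 2 / (300 ^+ 2 * 32) ->
  (21 * c + 25) / c1 <= u -> (21 * c + 23) / c2 <= u ->
  Pr p (fun J => ~~ early x0 T J) <= expR (- u).
Proof.
move=> hu2 hu3 hu4 hu5 hT c0 hc1 hc2 hu6 hu7.
have p2 : 0 < p ^+ 2 by exact: exprn_gt0.
have c10 : 0 < c1.
  by rewrite hc1; apply: divr_gt0 (ltr0Sn _ _); apply: exprn_gt0; exact: divr_gt0 p2 (ltr0Sn _ _).
have c20 : 0 < c2.
  by rewrite hc2; apply: (divr_gt0 p2); apply: mulr_gt0; [apply: exprn_gt0|]; exact: ltr0Sn.
have hN1 : N%:R + 1 <= expR (21 * u).
  apply: (@le_trans _ _ (u ^+ 21)).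
    have u2 : 16 <= u.
      apply: le_trans hu2; rewrite ler_pdivlMr //; by have := hp1; clear - hp0 hp1 hu1 hN; lra.
    have := ler_wpM2r (ltW (exprn_gt0 20 u_gt0)) u2; rewrite -exprS hN.
    by have := u_pow_ge1 20; clear - hp0 hp1 hu1 hN; lra.
  rewrite expRM_natl; apply: lerXn2r; rewrite ?nnegrE ?expR_ge0 ?ltW //.
  by have := expR_ge1Dx u; clear - hp0 hp1 hu1 hN; lra.
pose B s := [&& s \in reach x0 T, (u ^+ 9 / 2 <= mag s)%R & (mag s <= 384 / p ^+ 2 * u ^+ 10)%R].
pose E s J : bool := (pull s J < mu / 16 * N%:R)%R.
apply: (@le_trans _ _ (Pr p (fun J => [exists s, B s && E s J]))).
  apply: le_Pr => // J; rewrite negb_forall => /existsP[s]; rewrite !negb_imply -ltNge => /and4P[a1 a2 a3 a4].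
  by apply/existsP; exists s; rewrite /B /E a1 a2 a3.
have cardB : #|B|%:R <= expR (21 * u) ^+ T.
  apply: (@le_trans _ _ (N.+1 ^ T)%:R).
    rewrite ler_nat; apply: leq_trans (card_reach x0 T).
    by apply: subset_leq_card; apply/fintype.subsetP => s /and3P[].
  rewrite natrX; apply: lerXn2r; rewrite ?nnegrE ?expR_ge0 ?ler0n //.
  by rewrite -natr1.
have [D hD] : exists D : R, D = N%:R *
  (expR (2 * u ^+ 15 - (p ^+ 2 * u ^+ 8 / 2400) ^+ 2 / 8192)
          + expR (- (p ^+ 2 * u ^+ 13 / (300 ^+ 2 * 32)))) by eexists.
apply: (le_trans (Pr_union hp0 hp1 (c := D) _)).
  by move=> s /and3P[_ a1 a2]; rewrite hD; exact: pr_early_config.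
have D0 : 0 <= D by rewrite hD; apply: (mulr_ge0 (ler0n _ _)); apply: addr_ge0; exact: expR_ge0.
apply: (le_trans (ler_wpM2r D0 cardB)).
have eA : (p ^+ 2 * u ^+ 8 / 2400) ^+ 2 / 8192 = c1 * u ^+ 16 by rewrite hc1; field.
have eB : p ^+ 2 * u ^+ 13 / (300 ^+ 2 * 32) = c2 * u ^+ 13 by rewrite hc2; field.
rewrite eA eB in hD.
have hN' : N%:R <= expR (21 * u) by move: hN1; clear - hp0 hp1 hu1 hN; lra.
have i1 : (21 * c + 25) * u ^+ 15 <= c1 * u ^+ 16.
  have := dominate hu6 (isT : 15 < 16)%N.
  by rewrite mulrAC ler_pdivrMr // [u ^+ 16 * _]mulrC.
have i2 : (21 * c + 23) * u ^+ 12 <= c2 * u ^+ 13.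
  have := dominate hu7 (isT : 12 < 13)%N.
  by rewrite mulrAC ler_pdivrMr // [u ^+ 13 * _]mulrC.
have iT : T%:R * (21 * u) <= 21 * c * u ^+ 12.
  have u21 : 0 <= 21 * u by exact: mulr_ge0 (ler0n _ _) (ltW u_gt0).
  apply: (le_trans (ler_wpM2r u21 hT)).
  by rewrite (exprS u 11); clear - hp0 hp1 hu1 hN; lra.
have u12 : u <= u ^+ 12 by rewrite -[leLHS]expr1 leXu.
have u15 : u ^+ 12 <= u ^+ 15 by rewrite leXu.
have cu : c * u ^+ 12 <= c * u ^+ 15 by rewrite ler_wpM2l.
have two : 2 * expR (- 1 - u) <= expR (- u).
  rewrite expRD mulrA ler_piMl ?expR_ge0 //.
  rewrite expRN ler_pdivrMr ?expR_gt0 // mul1r.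
  by have := expR_ge1Dx (1 : R); clear - hp0 hp1 hu1 hN; lra.
apply: le_trans two; rewrite hD mulrCA mulrA mulrDr.
have {}hN' : N%:R * expR (21 * u) ^+ T <= expR (21 * u + T%:R * (21 * u)).
  rewrite expRD [expR (T%:R * _)]expRM_natl.
  exact: ler_wpM2r (exprn_ge0 _ (expR_ge0 _)) _ _ hN'.
have k1 : N%:R * expR (21 * u) ^+ T * expR (2 * u ^+ 15 - c1 * u ^+ 16) <= expR (- 1 - u).
  apply: (le_trans (ler_wpM2r (expR_ge0 _) hN')); rewrite -expRD ler_expR.
  by have := hu1; move: i1 iT u12 u15 cu; clear - hp0 hp1 hu1 hN; lra.
have k2 : N%:R * expR (21 * u) ^+ T * expR (- (c2 * u ^+ 13)) <= expR (- 1 - u).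
  apply: (le_trans (ler_wpM2r (expR_ge0 _) hN')); rewrite -expRD ler_expR.
  by have := hu1; move: i2 iT u12 cu; clear - hp0 hp1 hu1 hN; lra.
by move: k1 k2; clear - hp0 hp1 hu1 hN; lra.
Qed.

End GoodCouplings.

(** * Escape probabilities of the dynamics *)

Section Dynamics.
Variables (R : realType) (N : nat) (J : couplings N).
Hypothesis N_gt0 : (0 < N)%N.
Implicit Types (s : config N) (i : 'I_N) (f g : config N -> R).

Local Notation h := (local_field R [set: 'I_N]%SET).
Local Notation mag := (magnetization R).
Local Notation rate := (flip_prob R J).

Definition all_plus : config N := [ffun=> true].

Definition generator f s : R := \sum_i rate s i * (f (flip i s) - f s).

(** The one-step transition operator, see [sum_transition]. *)
Definition evolve f s : R := f s + generator f s.

Lemma NR_gt0 : 0 < N%:R :> R. Proof. by rewrite ltr0n. Qed.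

Lemma sum_transition f s : \sum_s' transition R J s s' * f s' = evolve f s.
Proof.
rewrite /transition; under eq_bigr do rewrite mulrDl.
rewrite big_split /=.
rewrite [X in _ + X](bigD1 s) //= eqxx mulr1 [X in _ + (_ + X)]big1 ?addr0; last first.
  by move=> s' /negbTE ->; rewrite mulr0 mul0r.
under eq_bigr do rewrite mulr_suml.
rewrite exchange_big /= (eq_bigr (fun i => rate s i * f (flip i s))); last first.
  move=> i _; rewrite (bigD1 (flip i s)) //= eqxx mulr1 big1 ?addr0 //.
  by move=> s' /negbTE ->; rewrite mulr0 mul0r.
rewrite /evolve /generator [X in _ = _ + X](eq_bigr (fun i => rate s i * f (flip i s) - rate s i * f s)).
  by rewrite sumrB -mulr_suml; ring.
by move=> i _; rewrite mulrBr.
Qed.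

Lemma rate_ge0 s i : 0 <= rate s i.
Proof.
by apply: mulr_ge0; rewrite ?invr_ge0 ?ler0n //; apply: addr_ge0; rewrite ?mulr_ge0 ?invr_ge0 ?ler0n.
Qed.

Lemma rate_le s i : rate s i <= N%:R^-1.
Proof.
rewrite flip_probE invfM -[leRHS]mulr1 mulrAC mulrC ler_pM2l ?invr_gt0 ?NR_gt0 //.
by rewrite /spin; case: (s i); case: sgrP => _; lra.
Qed.

Lemma sum_rate_le1 s : \sum_i rate s i <= 1.
Proof.
apply: (@le_trans _ _ (\sum_(i < N) N%:R^-1)); first by apply: ler_sum => i _; exact: rate_le.
by rewrite sumr_const card_ord -(mulr_natr N%:R^-1) mulVf // gt_eqF ?NR_gt0.
Qed.

Lemma le_evolve f g s : f s <= g s -> (forall i, f (flip i s) <= g (flip i s)) ->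
  evolve f s <= evolve g s.
Proof.
move=> h0 h1; rewrite /evolve /generator.
have e F : \sum_i rate s i * (F (flip i s) - F s) = \sum_i rate s i * F (flip i s) - (\sum_i rate s i) * F s.
  by rewrite mulr_suml -sumrB; apply: eq_bigr => i _; rewrite mulrBr.
rewrite !e.
have a1 : \sum_i rate s i * f (flip i s) <= \sum_i rate s i * g (flip i s).
  by apply: ler_sum => i _; apply: ler_wpM2l; rewrite ?rate_ge0.
have a2 : (1 - \sum_i rate s i) * f s <= (1 - \sum_i rate s i) * g s.
  by apply: ler_wpM2l; rewrite ?subr_ge0 ?sum_rate_le1.
by move: a1 a2; set S := \sum_i rate s i; lra.
Qed.

Lemma evolveD f g s : evolve (fun s' => f s' + g s') s = evolve f s + evolve g s.
Proof.
rewrite /evolve /generator addrACA -big_split; congr (_ + _).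
by apply: eq_bigr => i _ /=; ring.
Qed.

Lemma evolveZ (c : R) f s : evolve (fun s' => c * f s') s = c * evolve f s.
Proof.
rewrite /evolve /generator mulrDr mulr_sumr; congr (_ + _).
by apply: eq_bigr => i _ /=; ring.
Qed.

Lemma evolve_cst (c : R) s : evolve (fun=> c) s = c.
Proof. by rewrite /evolve /generator big1 ?addr0 // => i _; rewrite subrr mulr0. Qed.

Lemma mag_flip s i : mag (flip i s) = mag s - 2 * spin R (s i).
Proof.
rewrite !magnetizationE (bigD1 i) //= [in RHS](bigD1 i) //= spin_flip eqxx.
rewrite (eq_bigr (fun j => spin R (s j))); last by move=> j /negbTE ji; rewrite spin_flip ji mul1r.
by ring.
Qed.

(** The probability that the chain started at the argument is not at [all_plus] after [n] updates. *)
Fixpoint miss (n : nat) : config N -> R :=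
  if n is n'.+1 then evolve (miss n') else fun s => (s != all_plus)%:R.

Lemma miss_le1 n s : miss n s <= 1.
Proof.
elim: n s => [|n IH] s /=; first by case: (_ == _).
by rewrite -[leRHS](evolve_cst 1 s); apply: le_evolve.
Qed.

Section Drift.
Variables (l d : R).
Hypotheses (d0 : 0 < d) (d1 : d <= 1) (hl : l = d / 32).

Let l0 : 0 < l. Proof. by rewrite hl divr_gt0. Qed.

(** The first-order term of [exp (- l M)] contributes [- l] times the drift; as the steps of [M] are
bounded by 2, the second-order term is at most [8 l ^ 2], a quarter of [l d] for [l = d / 32]. *)
Lemma evolve_exp (b : R) s : d * N%:R <= pull R s J ->
  evolve (fun s' => expR (- l * (mag s' - b))) s
  <= (1 - 3 / 4 * (l * d)) * expR (- l * (mag s - b)).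
Proof.
move=> hs; rewrite /evolve /generator; set e := expR (- l * (mag s - b)).
have e0 : 0 < e by exact: expR_gt0.
have st i : rate s i * (expR (- l * (mag (flip i s) - b)) - e) <=
   e * (rate s i * (2 * l * spin R (s i)) + rate s i * (8 * l ^+ 2)).
  rewrite mag_flip.
  have -> : - l * (mag s - 2 * spin R (s i) - b) = 2 * l * spin R (s i) + - l * (mag s - b) by ring.
  rewrite expRD -/e.
  have -> : rate s i * (expR (2 * l * spin R (s i)) * e - e) =
    e * (rate s i * (expR (2 * l * spin R (s i)) - 1)) by ring.
  rewrite ler_pM2l // -mulrDr; apply: ler_wpM2l; first exact: rate_ge0.
  have := @expR_le_quadratic R (2 * l * spin R (s i)); rewrite !exprMn [spin R _ ^+ 2]expr2 sqr_spin mulr1.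
  have l4 : l <= 4^-1 by rewrite hl; move: d1; lra.
  move=> hq; rewrite lerBlDl; apply: le_trans (hq _) _; last by lra.
  by rewrite /spin; case: (s i); move: l0 l4; lra.
apply: (@le_trans _ _ (e + \sum_i e * (rate s i * (2 * l * spin R (s i)) + rate s i * (8 * l ^+ 2)))).
  by rewrite lerD2l; apply: ler_sum => i _; exact: st.
rewrite -mulr_sumr big_split /= -mulr_suml.
rewrite (eq_bigr (fun i => l / N%:R * (spin R (s i) - Num.sg (h s J i)))); last first.
  move=> i _; rewrite flip_probE.
  have := sqr_spin R (s i); set a := spin R (s i); set g := Num.sg _ => ha.
  have -> : (2 * N%:R)^-1 * (1 - a * g) * (2 * l * a) = l / N%:R * (a - (a * a) * g).
    by field; rewrite gt_eqF ?NR_gt0.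
  by rewrite ha mul1r.
rewrite -mulr_sumr sumrB -magnetizationE.
have -> : mag s - \sum_i Num.sg (h s J i) = - pull R s J by rewrite /pull opprB.
rewrite mulrN.
have a1 : l * d <= l / N%:R * pull R s J.
  by rewrite -mulrA ler_pM2l // mulrC ler_pdivlMr ?NR_gt0.
have a2 : (\sum_i rate s i) * (8 * l ^+ 2) <= 8 * l ^+ 2.
  by rewrite ler_piMl ?sum_rate_le1 // mulr_ge0 // sqr_ge0.
have a3 : 8 * l ^+ 2 = l * d / 4 by rewrite hl; field.
rewrite -[X in X + _]mulr1 -mulrDr mulrC ler_pM2r //.
move: a1 a2 a3; set S := _ * (8 * _); set Q := _ * pull _ _ _; lra.
Qed.

Variables (th b0 : R) (x0 : config N) (T : nat).
Let bar (t : nat) := b0 + d / 2 * t%:R.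
Hypotheses (hA : forall s, bar T <= mag s -> mag s <= th -> d * N%:R <= pull R s J)
  (hB : forall s, s \in reach x0 T -> b0 <= mag s -> mag s < bar T -> d * N%:R <= pull R s J)
  (hC : forall s i, th <= mag s -> 0 < h s J i) (hD : bar T < th).

(** The potential for crossing the barrier [b]. It is set to 0 above [th], a region that the chain
never leaves: near the all-plus configuration the drift is too small to follow a rising barrier. *)
Definition escape (b : R) s : R := if th <= mag s then 0 else expR (- l * (mag s - b)).

Lemma escape_ge0 b s : 0 <= escape b s.
Proof. by rewrite /escape; case: ifP => // _; exact: expR_ge0. Qed.

Lemma escape_ge1 b s : mag s < b -> b <= th -> 1 <= escape b s.
Proof.
move=> sb bt; rewrite /escape (lt_geF (lt_le_trans sb bt)).
rewrite -[leLHS]expR0 ler_expR mulNr oppr_ge0.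
by apply: mulr_ge0_le0; [exact: ltW|move: sb; lra].
Qed.

Lemma rate_top s i : th <= mag s -> rate s i = if s i then 0 else N%:R^-1.
Proof.
move=> hs; rewrite flip_probE gtr0_sg ?hC // mulr1 /spin.
case: (s i); first by rewrite subrr mulr0.
by field; rewrite gt_eqF ?NR_gt0.
Qed.

(** Raising the barrier by half the guaranteed drift keeps [escape] a supermartingale. *)
Lemma evolve_escape b s : th <= mag s \/ d * N%:R <= pull R s J ->
  evolve (escape b) s <= escape (b - d / 2) s.
Proof.
have [hs _|hs [//|hp]] := leP th (mag s).
  rewrite /evolve /generator /escape hs big1 ?addr0 // => i _.
  rewrite rate_top //; case si: (s i); first by rewrite mul0r.
  by rewrite mag_flip si /spin ifT ?subrr ?mulr0 //; move: hs; lra.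
apply: (@le_trans _ _ (evolve (fun s' => expR (- l * (mag s' - b))) s)).
  have e s' : escape b s' <= expR (- l * (mag s' - b)).
    by rewrite /escape; case: ifP => // _; exact: expR_ge0.
  by apply: le_evolve => // i; exact: e.
apply: (le_trans (evolve_exp b hp)).
rewrite /escape (lt_geF hs).
have -> : - l * (mag s - (b - d / 2)) = - (l * d / 2) + - l * (mag s - b) by field.
rewrite expRD; apply: ler_wpM2r; first exact: expR_ge0.
apply: le_trans (expR_ge1Dx _).
have : 0 <= l * d by apply: mulr_ge0; exact: ltW.
lra.
Qed.

Lemma escape_mono b b' s : b <= b' -> escape b s <= escape b' s.
Proof.
move=> bb; rewrite /escape; case: ifP => // _.
rewrite ler_expR !mulNr lerN2 ler_pM2l //; lra.
Qed.

Definition gap s : R := expR (- l * mag s) - expR (- l * N%:R).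

Lemma mag_le s : mag s <= N%:R.
Proof.
rewrite magnetizationE -[X in _ <= X%:R](card_ord N) -sum1_card natr_sum.
by apply: ler_sum => i _; rewrite /spin; case: (s i); lra.
Qed.

Lemma neq_all_plus s : s != all_plus -> exists i, ~~ s i.
Proof.
move=> hs; apply/existsP; rewrite -negb_forall; apply: contra hs => /forallP hs.
by apply/eqP/ffunP => i; rewrite ffunE; exact: hs.
Qed.

Lemma mag_neq s : s != all_plus -> mag s <= N%:R - 2.
Proof.
move=> /neq_all_plus[i si]; have := mag_le (flip i s); rewrite mag_flip (negbTE si) /spin; lra.
Qed.

Lemma gap_ge0 s : 0 <= gap s.
Proof. by rewrite subr_ge0 ler_expR !mulNr lerN2 ler_pM2l // mag_le. Qed.

(** Below [th] the drift makes [gap] contract. Above [th] it contracts because each minus spin is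
flipped as soon as it is selected, so some minus spin is flipped with probability at least
[1 / N]. *)
Lemma evolve_gap : exists2 k : R, 0 < k <= 1 &
  forall s, th <= mag s \/ d * N%:R <= pull R s J -> evolve gap s <= (1 - k) * gap s.
Proof.
pose k := Num.min (3 / 4 * (l * d)) (N%:R^-1 * (1 - expR (- (2 * l)))).
have ld : 0 < l * d by exact: mulr_gt0.
have k1 : k <= 3 / 4 * (l * d) by rewrite ge_min lexx.
have k2 : k <= N%:R^-1 * (1 - expR (- (2 * l))) by rewrite ge_min lexx orbT.
have el : expR (- (2 * l)) < 1.
  by rewrite -[ltRHS]expR0 ltr_expR; move: l0; lra.
exists k.
  rewrite lt_min; apply/andP; split; first (apply/andP; split).
  - by move: ld; lra.
  - by rewrite mulr_gt0 ?invr_gt0 ?NR_gt0 // subr_gt0.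
  apply: (le_trans k1); rewrite hl; have : d * d <= 1 by rewrite mulr_ile1 // ltW.
  lra.
have eN0 := expR_ge0 (- l * N%:R).
move=> s hs; have := gap_ge0 s.
have k0 : 0 <= k.
  rewrite le_min; apply/andP; split; first by move: ld; lra.
  by rewrite mulr_ge0 ?invr_ge0 ?ler0n // subr_ge0 ltW.
have kN : 0 <= k * expR (- l * N%:R) by exact: mulr_ge0.
case: hs => [hs|hs] g0; last first.
  have := evolve_exp 0 hs.
  rewrite /gap evolveD evolve_cst !subr0.
  rewrite (_ : evolve _ s = evolve (fun s' => expR (- l * mag s')) s); last first.
    by rewrite /evolve /generator subr0; congr (_ + _); apply: eq_bigr => i _; rewrite subr0.
  have := ler_wpM2r (expR_ge0 (- l * mag s)) k1.
  by move: kN; lra.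
have [es|/neq_all_plus[i si]] := eqVneq s all_plus.
  have gs : gap s = 0.
    rewrite /gap magnetizationE es (eq_bigr (fun=> 1)); last by move=> i _; rewrite ffunE.
    by rewrite sumr_const card_ord subrr.
  rewrite gs mulr0 /evolve /generator gs add0r big1 // => i _.
  by rewrite rate_top // es ffunE mul0r.
have e i' : rate s i' * (gap (flip i' s) - gap s) =
   - (if s i' then 0 else N%:R^-1 * (1 - expR (- (2 * l)))) * expR (- l * mag s).
  rewrite rate_top //; case si': (s i'); first by rewrite oppr0 !mul0r.
  rewrite /gap mag_flip si' /spin.
  have -> : - l * (mag s - 2 * -1) = - l * mag s + - (2 * l) by ring.
  by rewrite expRD; ring.
rewrite /evolve /generator (bigD1 i) //= e (negbTE si).
have : \sum_(j | j != i) rate s j * (gap (flip j s) - gap s) <= 0.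
  apply: sumr_le0 => j _; rewrite e mulNr oppr_le0 mulr_ge0 ?expR_ge0 //.
  by case: (s j) => //; rewrite mulr_ge0 ?invr_ge0 ?ler0n // subr_ge0 ltW.
have := ler_wpM2r (expR_ge0 (- l * mag s)) k2.
set S := \sum_(j | _) _ => hk hS.
by move: kN hk hS; rewrite /gap; lra.
Qed.

Lemma reach_mono t t' s : (t <= t')%N -> s \in reach x0 t -> s \in reach x0 t'.
Proof.
move=> + st; elim: t' => [|t' IH]; first by rewrite leqn0 => /eqP <-.
by rewrite leq_eqVlt => /orP[/eqP <- //|/IH] /=; rewrite inE => ->.
Qed.

Lemma escape_or_drift t s : (t <= T)%N -> s \in reach x0 t -> bar t <= mag s ->
  th <= mag s \/ d * N%:R <= pull R s J.
Proof.
move=> tT st bt; case: (leP th (mag s)) => [|hs]; [by left|right].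
have [bT|Tb] := leP (bar T) (mag s); first by apply: hA => //; exact: ltW.
apply: hB => //; first exact: reach_mono tT st.
by apply: le_trans bt; rewrite /bar lerDl mulr_ge0 // divr_ge0 // ltW.
Qed.

(** Below the barrier [escape] is at least 1 and the bound is trivial; above it both potentials are
supermartingales. This replaces a stopping time. *)
Lemma miss_late (k C : R) : 0 < k <= 1 ->
  (forall s, th <= mag s \/ d * N%:R <= pull R s J -> evolve gap s <= (1 - k) * gap s) ->
  0 <= C -> (forall s, s != all_plus -> 1 <= C * gap s) ->
  forall n s, miss n s <= escape (bar T) s + (1 - k) ^+ n * (C * gap s).
Proof.
move=> /andP[k0 k1] hk C0 hC1; have k1' : 0 <= 1 - k by rewrite subr_ge0.
have Cg s : 0 <= C * gap s by rewrite mulr_ge0 ?gap_ge0.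
elim=> [|n IH] s.
  rewrite expr0 mul1r /=; have := escape_ge0 (bar T) s.
  case: eqP => [_|/eqP /hC1] /=; first by have := Cg s; lra.
  by lra.
have [sb|bs] := ltP (mag s) (bar T).
  have := escape_ge1 sb (ltW hD); have := miss_le1 n.+1 s.
  have : 0 <= (1 - k) ^+ n.+1 * (C * gap s) by rewrite mulr_ge0 // exprn_ge0.
  lra.
have good : th <= mag s \/ d * N%:R <= pull R s J.
  by case: (leP th (mag s)) => [|hs]; [left|right; apply: hA => //; exact: ltW].
rewrite /=; apply: (@le_trans _ _ (evolve (fun s' => escape (bar T) s' + (1 - k) ^+ n * C * gap s') s)).
  by apply: le_evolve => [|i]; rewrite -mulrA; exact: IH.
rewrite evolveD evolveZ; apply: lerD.
  apply: le_trans (evolve_escape (bar T) good) _; apply: escape_mono.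
  by move: d0; lra.
have -> : (1 - k) ^+ n.+1 * (C * gap s) = (1 - k) ^+ n * C * ((1 - k) * gap s).
  by rewrite exprS; ring.
by apply: ler_wpM2l; [rewrite mulr_ge0 // exprn_ge0|exact: hk].
Qed.

(** Backwards in time: with [r] updates left before time [T], the chain is in [reach x0 (T - r)] and the
barrier stands at [bar (T - r)]. *)
Lemma miss_early (k C : R) : 0 < k <= 1 ->
  (forall s, th <= mag s \/ d * N%:R <= pull R s J -> evolve gap s <= (1 - k) * gap s) ->
  0 <= C -> (forall s, s != all_plus -> 1 <= C * gap s) ->
  forall n r s, (r <= T)%N -> s \in reach x0 (T - r) ->
  miss (r + n) s <= escape (bar (T - r)) s + (1 - k) ^+ n * (C * gap s).
Proof.
move=> hk01 hk C0 hC1 n; have /andP[k0 k1] := hk01; have k1' : 0 <= 1 - k by rewrite subr_ge0.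
have Cg s : 0 <= C * gap s by rewrite mulr_ge0 ?gap_ge0.
elim=> [|r IH] s rT sr; first by rewrite subn0; exact: miss_late.
have e : (T - r = (T - r.+1).+1)%N by rewrite subnSK.
have le_bar : bar (T - r.+1) <= bar T.
  by rewrite /bar lerD2l ler_wpM2l ?ler_nat ?leq_subr // divr_ge0 // ltW.
have [sb|bs] := ltP (mag s) (bar (T - r.+1)).
  have := escape_ge1 sb (le_trans le_bar (ltW hD)); have := miss_le1 (r.+1 + n) s.
  have : 0 <= (1 - k) ^+ n * (C * gap s) by rewrite mulr_ge0 // exprn_ge0.
  lra.
have good := escape_or_drift (leq_subr _ _) sr bs.
rewrite addSn /=.
apply: (@le_trans _ _ (evolve (fun s' => escape (bar (T - r)) s' + (1 - k) ^+ n * C * gap s') s)).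
  apply: le_evolve => [|i]; rewrite -mulrA; apply: IH; rewrite ?(ltnW rT) // e /= inE.
    by rewrite sr.
  apply/orP; right; apply/imsetP; exists (s, i) => //.
  by rewrite finset.in_setX sr inE.
rewrite evolveD evolveZ; apply: lerD.
  apply: le_trans (evolve_escape _ good) _.
  by rewrite e /bar -natr1; apply: escape_mono; lra.
rewrite -mulrA; apply: ler_wpM2l; first exact: exprn_ge0.
apply: ler_wpM2l => //; apply: (le_trans (hk s good)).
by rewrite ler_piMl ?gap_ge0 //; move: k0; lra.
Qed.

(** [escape] bounds the probability that the magnetization ever drops below the barrier, and [gap]
decays geometrically as long as it does not. *)
Lemma miss_small (eta : R) : 0 < eta ->
  exists n, miss n x0 <= expR (- l * (mag x0 - b0)) + eta.
Proof.
move=> eta0; have [k hk01 hk] := evolve_gap; have /andP[k0 k1] := hk01.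
have v0 : 0 < expR (- l * (N%:R - 2)) - expR (- l * N%:R).
  by rewrite subr_gt0 ltr_expR !mulNr ltrN2 ltr_pM2l //; lra.
set v := _ - _ in v0; pose C := v^-1.
have C0 : 0 <= C by rewrite invr_ge0 ltW.
have hC1 s : s != all_plus -> 1 <= C * gap s.
  move=> /mag_neq sN; rewrite mulrC ler_pdivlMr // mul1r /v /gap lerD2r ler_expR.
  by rewrite !mulNr lerN2 ler_pM2l.
pose n := (Num.truncn (C * gap x0 / (k * eta))).+1.
exists (T + n)%N.
have := @miss_early k C hk01 hk C0 hC1 n T x0 (leqnn _).
rewrite subnn /= inE eqxx => /(_ isT) h1.
have h2 : escape (bar 0) x0 <= expR (- l * (mag x0 - b0)).
  by rewrite /escape /bar mulr0 addr0; case: ifP => // _; exact: expR_ge0.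
apply: (le_trans h1); apply: (lerD h2).
have ke : 0 < k * eta by exact: mulr_gt0.
have g0 : 0 <= C * gap x0 / (k * eta) by rewrite divr_ge0 ?mulr_ge0 ?gap_ge0 // ltW.
have hn : C * gap x0 <= n%:R * (k * eta).
  by rewrite -ler_pdivrMr //; have := truncn_itv g0; rewrite -/n => /andP[_ /ltW].
have pk : (1 - k) ^+ n <= expR (- (n%:R * k)).
  rewrite -mulrN expRM_natl; apply: lerXn2r; rewrite ?nnegrE ?expR_ge0 ?subr_ge0 //.
  exact: expR_ge1Dx.
have pk' : expR (- (n%:R * k)) * (n%:R * k) <= 1.
  rewrite expRN mulrC ler_pdivrMr ?expR_gt0 // mul1r.
  by apply: le_trans (expR_ge1Dx _); rewrite lerDr.
apply: (le_trans (ler_wpM2r _ pk)); first by rewrite mulr_ge0 ?gap_ge0.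
apply: (le_trans (ler_wpM2l (expR_ge0 _) hn)).
have -> : expR (- (n%:R * k)) * (n%:R * (k * eta)) = expR (- (n%:R * k)) * (n%:R * k) * eta by ring.
by rewrite ler_piMl // ltW.
Qed.

End Drift.

End Dynamics.

Local Open Scope classical_set_scope.
Local Open Scope ring_scope.

(** * From transition probabilities to trajectories *)

Lemma measure_partition (R : realType) (d : measure_display) (T : measurableType d)
  (mu : {measure set T -> \bar R}) (F : finType) (Y : T -> F) (B : set T) :
  measurable B -> (forall y, measurable [set w | Y w = y]) ->
  mu B = (\sum_(y : F) mu (B `&` [set w | Y w = y]))%E.
Proof.
move=> mB mY; pose G y := B `&` [set w | Y w = y].
have -> : mu B = mu (\bigcup_(y in [set: F]) G y).
  congr (mu _); apply/seteqP; split=> [w Bw|w [y _ []] //].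
  by exists (Y w).
rewrite measure_fin_bigcup; last 3 first.
- exact: finite_finset.
- by move=> y y' _ _ [w [[_ <-] [_ <-]]].
- by move=> y _; exact: measurableI.
have -> : [set: F] = [set` index_enum F].
  by apply/seteqP; split=> // y _ /=; rewrite mem_index_enum.
by rewrite -fsbig_seq // index_enum_uniq.
Qed.

Section Trajectories.
Variables (R : realType) (p : R) (N : nat) (x0 : config N).
Variables (d : measure_display) (T : measurableType d) (P : probability T R).
Variables (J : T -> couplings N) (X : nat -> T -> config N).
Hypothesis H : zero_temp_dynamics p x0 P J X.

Definition path_event j t (x : nat -> config N) : set T :=
  [set w | J w = j /\ forall u, (u <= t)%N -> X u w = x u].

Definition path_mass j t (x : nat -> config N) : R :=
  couplings_law p j * (x 0%N == x0)%:R * \prod_(u < t) transition R j (x u) (x u.+1).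

Let mJ j : measurable [set w | J w = j]. Proof. by case: H. Qed.
Let mX t s : measurable [set w | X t w = s]. Proof. by case: H. Qed.

Lemma path_eventE j t x : P (path_event j t x) = (path_mass j t x)%:E.
Proof. by case: H => _ _ ->. Qed.

Lemma measurable_path_event j t x : measurable (path_event j t x).
Proof.
have -> : path_event j t x = [set w | J w = j] `&` \bigcap_(u in [set u | (u <= t)%N]) [set w | X u w = x u].
  by apply/seteqP; split.
by apply: measurableI => //; apply: bigcap_measurableType => u _.
Qed.

Definition extend t (x : nat -> config N) s := fun u => if (u <= t)%N then x u else s.

Lemma path_event_extend j t x s :
  path_event j t x `&` [set w | X t.+1 w = s] = path_event j t.+1 (extend t x s).
Proof.
apply/seteqP; split=> [w [[Jw Xw] Xs]|w [Jw Xw]].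
  split=> // u; rewrite leq_eqVlt ltnS /extend => /orP[/eqP ->|ut]; first by rewrite ltnn.
  by rewrite ut; exact: Xw.
split; last by have := Xw t.+1 (leqnn _); rewrite /extend ltnn.
by split=> // u ut; have := Xw u (leqW ut); rewrite /extend ut.
Qed.

Lemma path_mass_extend j t x s :
  path_mass j t.+1 (extend t x s) = path_mass j t x * transition R j (x t) s.
Proof.
rewrite /path_mass big_ord_recr /= mulrA {1 4 5}/extend ltnn leqnn leq0n; congr (_ * _ * _).
by apply: eq_bigr => u _; rewrite /extend (ltnW (ltn_ord u)) ltn_ord.
Qed.

Lemma measurable_state t (A : pred (config N)) : measurable [set w | A (X t w)].
Proof.
have -> : [set w | A (X t w)] = \bigcup_(s in [set s | A s]) [set w | X t w = s].
  by apply/seteqP; split=> [w Aw|w [s As /= ->] //]; exists (X t w).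
by apply: fin_bigcup_measurable => // ; exact: finite_finset.
Qed.

(** By induction on [n], splitting according to the value of the next state; the cylinder
probabilities are only needed one step at a time. *)
Lemma path_event_miss j n t x :
  P (path_event j t x `&` [set w | X (n + t)%N w != @all_plus N])
  = (path_mass j t x * miss R j n (x t))%:E.
Proof.
elim: n t x => [|n IH] t x.
  rewrite add0n /=; have [xt|xt] := eqVneq (x t) (@all_plus N).
    rewrite mulr0 (_ : _ `&` _ = set0) ?measure0 //.
    by apply/seteqP; split=> // w [[_ /(_ t (leqnn _)) e] /=]; rewrite e xt eqxx.
  rewrite mulr1 -path_eventE; congr (P _); apply/seteqP; split=> [w []//|w hw]; split=> //.
  by case: hw => _ /(_ t (leqnn _)) e /=; rewrite e.
rewrite (measure_partition _ (Y := X t.+1)) //; last first.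
  by apply: measurableI; [exact: measurable_path_event|exact: (measurable_state _ (predC1 _))].
transitivity (\sum_(s : config N) (path_mass j t x * (transition R j (x t) s * miss R j n s))%:E)%E.
  apply: eq_bigr => s _; rewrite setIAC path_event_extend addSn -addnS.
  apply: etrans (IH t.+1 (extend t x s)) _.
  by rewrite path_mass_extend /extend ltnn mulrA.
rewrite sumEFin -mulr_sumr sum_transition //.
Qed.

(** The induction of [path_event_miss] reduces this to [n = 0], where the event is contained in that of
missing all-plus one update after being there. *)
Lemma path_event_leave j n t x : (forall i, flip_prob R j (@all_plus N) i = 0) ->
  P (path_event j t x `&` [set w | (X (n + t)%N w == @all_plus N) && (X (n + t).+1 w != @all_plus N)]) = 0%E.
Proof.
move=> hr.
have mS k : measurable [set w | (X k w == @all_plus N) && (X k.+1 w != @all_plus N)].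
  have -> : [set w | (X k w == @all_plus N) && (X k.+1 w != @all_plus N)]
    = [set w | X k w == @all_plus N] `&` [set w | X k.+1 w != @all_plus N].
    by apply/seteqP; split=> w /=; [move/andP|move=> [? ?]; apply/andP].
  by apply: measurableI; [exact: (measurable_state k (pred1 _))|exact: (measurable_state k.+1 (predC1 _))].
elim: n t x => [|n IH] t x.
  rewrite add0n; have [xt|xt] := eqVneq (x t) (@all_plus N); last first.
    rewrite (_ : _ `&` _ = set0) ?measure0 //.
    by apply/seteqP; split=> // w [[_ /(_ t (leqnn _)) e] /=]; rewrite e (negbTE xt).
  apply/eqP; rewrite -measure_le0.
  apply: (@le_trans _ _ (P (path_event j t x `&` [set w | X (1 + t)%N w != @all_plus N]))).
    apply: le_measure; rewrite ?inE.
    - by apply: measurableI; [exact: measurable_path_event|exact: mS].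
    - by apply: measurableI; [exact: measurable_path_event|exact: (measurable_state _ (predC1 _))].
    - by move=> w [? /andP[_ ?]]; split.
  rewrite path_event_miss xt /= /evolve /generator eqxx big1 ?addr0 ?mulr0 // => i _.
  by rewrite hr mul0r.
rewrite (measure_partition _ (Y := X t.+1)) //; last first.
  by apply: measurableI; [exact: measurable_path_event|exact: mS].
apply: big1 => s _; rewrite setIAC path_event_extend addSn -addnS.
exact: IH.
Qed.

Definition absorbed : set T :=
  [set w | (fun t : nat => spins R (X t w)) @ \oo --> (const_mx 1 : 'rV[R]_N)].

(** The spins take finitely many values, so convergence means being eventually constant. *)
Lemma absorbedE : absorbed = \bigcup_t \bigcap_(u in [set u | (t <= u)%N]) [set w | X u w = @all_plus N].
Proof.
apply/seteqP; split=> w.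
  move=> hw.
  have h i : \forall t \near \oo, X t w i.
    have hc : (fun t : nat => spins R (X t w) 0 i) @ \oo --> (const_mx 1 : 'rV[R]_N) 0 i.
      exact: (cvg_comp _ _ hw (@coord_continuous R 1 N 0 i _)).
    move/cvgrPdist_lt: hc => /(_ 1 ltr01); apply: filterS => t.
    by rewrite mxE spinsE /spin; case: (X t w i) => //; rewrite opprK ger0_norm; lra.
  have [t _ ht] := filter_forall _ h.
  exists t => // u /= tu; apply/ffunP => i; rewrite ffunE; exact: (ht u tu i).
move=> [t _ ht]; apply: cvg_near_cst; exists t => // u /= tu.
by rewrite (ht u tu); apply/rowP => i; rewrite !mxE ffunE.
Qed.

Lemma measurable_absorbed : measurable absorbed.
Proof.
by rewrite absorbedE; apply: bigcup_measurable => t _; apply: bigcap_measurableType => u _.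
Qed.

(** On the path event, the chain is absorbed unless it misses all-plus at time [n] or leaves it
later, and the second possibility has probability 0. *)
Lemma path_event_not_absorbed j n x : (forall i, flip_prob R j (@all_plus N) i = 0) ->
  (P (path_event j 0 x `&` ~` absorbed) <= (path_mass j 0 x * miss R j n (x 0%N))%:E)%E.
Proof.
move=> hr; have := path_event_miss j n 0 x; rewrite addn0 => <-.
pose L k := path_event j 0 x `&` [set w | (X k w == @all_plus N) && (X k.+1 w != @all_plus N)].
have L0 k : P (L k) = 0%E by have := path_event_leave k 0 x hr; rewrite addn0.
have mL k : measurable (L k).
  apply: measurableI; first exact: measurable_path_event.
  have -> : [set w | (X k w == @all_plus N) && (X k.+1 w != @all_plus N)]
    = [set w | X k w == @all_plus N] `&` [set w | X k.+1 w != @all_plus N].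
    by apply/seteqP; split=> w /=; [move/andP|move=> [? ?]; apply/andP].
  by apply: measurableI; [exact: (measurable_state k (pred1 _))|exact: (measurable_state k.+1 (predC1 _))].
set B := path_event j 0 x `&` [set w | _].
have mB : measurable B.
  by apply: measurableI; [exact: measurable_path_event|exact: (measurable_state _ (predC1 _))].
have mU : measurable (\bigcup_k L k) by exact: bigcup_measurable.
have U0 : P (\bigcup_k L k) = 0%E.
  apply/eqP; rewrite -measure_le0.
  apply: le_trans (measure_sigma_subadditive P mL mU (@subset_refl _ _)) _.
  by rewrite eseries0 // => k _ _; exact: L0.
apply: (@le_trans _ _ (P (B `|` \bigcup_k L k))).
  apply: le_measure; rewrite ?inE.
  - by apply: measurableI; [exact: measurable_path_event|exact: measurableC measurable_absorbed].
  - exact: measurableU.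
  move=> w [hw na]; have [Xn|Xn] := eqVneq (X n w) (@all_plus N); last by left; split.
  right; apply: contrapT => nL; apply: na; rewrite absorbedE; exists n => // u /= nu.
  rewrite -(subnK nu); elim: (u - n)%N => // k IH; apply/eqP/negPn/negP => ne.
  apply: nL; exists (k + n)%N => //; split=> //; apply/andP; split; first exact/eqP.
  by rewrite -addSn.
apply: le_trans (measureU2 _ mB mU) _.
by rewrite [X in (_ + X)%E](_ : _ = 0%E) ?adde0 //; exact: U0.
Qed.

(** The number [n] of updates may depend on the couplings, so the bound is summed over their
values. *)
Lemma not_absorbed_le (good : pred (couplings N)) (e : R) : 0 < p -> p <= 1 -> 0 <= e ->
  (forall j, good j -> (forall i, flip_prob R j (@all_plus N) i = 0) /\
     exists n, miss R j n x0 <= e) ->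
  (P (~` absorbed) <= (Pr p (predC good) + e)%:E)%E.
Proof.
move=> p0 p1 e0 hgood.
have mA := measurableC measurable_absorbed.
rewrite (measure_partition _ (Y := J)) //.
apply: (@le_trans _ _ (\sum_j (couplings_law p j * ((~~ good j)%:R + e))%:E)%E); last first.
  rewrite sumEFin lee_fin /Pr /Ex; under eq_bigr do rewrite mulrDr.
  rewrite big_split /= lerD2l -mulr_suml.
  by have := Ex_cst p (edge N) e; rewrite /Ex -mulr_suml => ->.
apply: lee_sum => j _.
rewrite (measure_partition _ (Y := X 0%N)) //; last exact: measurableI.
have ev s : ~` absorbed `&` [set w | J w = j] `&` [set w | X 0%N w = s]
    = path_event j 0 (fun=> s) `&` ~` absorbed.
  apply/seteqP; split=> [w [[na Jw] Xw]|w [[Jw Xw] na]].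
    by split=> //; split=> // u; rewrite leqn0 => /eqP ->.
  by split; [split|exact: Xw].
have le_mass s : (P (~` absorbed `&` [set w | J w = j] `&` [set w | X 0%N w = s])
    <= (path_mass j 0 (fun=> s))%:E)%E.
  rewrite ev -path_eventE; apply: le_measure; rewrite ?inE.
  - by apply: measurableI => //; exact: measurable_path_event.
  - exact: measurable_path_event.
  - by move=> w [].
have law0 : 0 <= couplings_law p j by exact: weight_ge0.
rewrite (bigD1 x0) //= big1 ?adde0; last first.
  move=> s /negbTE sx; apply/eqP; rewrite -measure_le0; apply: le_trans (le_mass s) _.
  by rewrite /path_mass sx mulr0 mul0r.
case: (boolP (good j)) => gj /=; last first.
  apply: le_trans (le_mass x0) _; rewrite lee_fin /path_mass eqxx big_ord0 !mulr1.
  by rewrite ler_peMr // lerDl.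
have [hr [n hn]] := hgood j gj.
rewrite ev; apply: le_trans (path_event_not_absorbed n (fun=> x0) hr) _.
by rewrite lee_fin /path_mass eqxx big_ord0 !mulr1 add0r ler_wpM2l.
Qed.

End Trajectories.

(** * Choice of scales *)

Section Assembly.
Variables (R : realType) (p : R).
Hypotheses (hp0 : 0 < p) (hp1 : p <= 1).

(** The number of updates, in units of [u ^ 11], that the barrier takes to rise above the level
[384 / p ^ 2 * u ^ 10] from which [discrepancy] guarantees the drift. *)
Definition horizon : R := 9600 * 384 / p ^+ 3 + 1.

(** Each entry is a constant that [u] has to dominate for one polynomial inequality in [u]. *)
Definition thresholds : seq R :=
  [:: 1; 16 / p; 4000 / p ^+ 3; 12800 * 384 / p ^+ 3; 12800 / p;
      (21 * horizon + 25) / ((p ^+ 2 / 2400) ^+ 2 / 8192);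
      (21 * horizon + 23) / (p ^+ 2 / (300 ^+ 2 * 32));
      42 * 128 / p ^+ 2; 2 * (384 / p ^+ 2 + 1); 4800 * 64 / p].

Section FixedSize.
Variables (N : nat) (u : R) (x0 : config N).
Hypotheses (hu : all (fun c => c <= u) thresholds) (hN : N%:R = u ^+ 20).
Hypothesis hx0 : u ^+ 9 <= magnetization R x0.

Local Notation mag := (magnetization R).

Lemma u_ge1 : 1 <= u. Proof. by move: hu => /andP[]. Qed.

Lemma mag_all_plus : mag (@all_plus N) = N%:R.
Proof.
rewrite magnetizationE (eq_bigr (fun=> 1)); last by move=> i _; rewrite ffunE.
by rewrite sumr_const card_ord.
Qed.

(** The barrier rises by [mu / 32] per update, so it needs about
[32 K u ^ 10 / mu = 9600 K u ^ 11 / p] updates to rise by [K u ^ 10], where [K = 384 / p ^ 2]. *)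
Lemma drift_time : exists T : nat, [/\ T%:R <= horizon * u ^+ 11,
  384 / p ^+ 2 * u ^+ 10 <= u ^+ 9 / 2 + mu p u / 16 / 2 * T%:R &
  u ^+ 9 / 2 + mu p u / 16 / 2 * T%:R < (1 - p / 4) * N%:R].
Proof.
have u1 := u_ge1; have u0 : 0 < u by exact: lt_le_trans ltr01 u1.
have uX k : 1 <= u ^+ k by rewrite -(expr0 u); exact: leXu.
have p2 : 0 < p ^+ 2 by exact: exprn_gt0.
have p3 : 0 < p ^+ 3 by exact: exprn_gt0.
have [K hK] : exists K : R, K = 384 / p ^+ 2 by eexists.
have K0 : 0 < K by rewrite hK; exact: divr_gt0 (ltr0Sn _ _) p2.
have hu2 : 2 * (K + 1) <= u by move: hu; rewrite /= hK => /and5P[_ _ _ _ /and5P[_ _ _ _ /and3P[]]].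
have [z hz] : exists z : R, z = mu p u / 16 / 2 by eexists.
have u300 : 0 < 300 * u by exact: mulr_gt0 (ltr0Sn _ _) u0.
have mu0 : 0 < mu p u by exact: divr_gt0.
have mu1 : mu p u <= 1 by rewrite /mu ler_pdivrMr //; move: hp1 u1; lra.
have z0 : 0 < z by rewrite hz; move: mu0; lra.
have z1 : z <= 1 by rewrite hz; move: mu0 mu1; lra.
rewrite -hK -hz.
pose y := K * u ^+ 10 / z.
have y0 : 0 <= y by rewrite divr_ge0 ?mulr_ge0 ?exprn_ge0 // ltW.
have hy : y = 9600 * 384 / p ^+ 3 * u ^+ 11.
  by rewrite /y hK hz /mu; field; rewrite !lt0r_neq0.
have /andP[n1 n2] := truncn_itv y0; set n := Num.truncn y in n1 n2.
exists n.+1; rewrite -natr1 in n2 *.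
have zn : z * n%:R <= K * u ^+ 10 by rewrite mulrC -ler_pdivlMr.
have zn' : K * u ^+ 10 < z * (n%:R + 1) by rewrite [z * _]mulrC -ltr_pdivrMr.
split.
- rewrite /horizon mulrDl -hy mul1r; apply: lerD => //.
- by have := uX 9; move: zn'; lra.
have d1 : 2 * (K + 1) * u ^+ 10 <= u ^+ 20 by exact: dominate.
have d2 : u ^+ 9 <= u ^+ 10 by exact: leXu.
have d3 : p * u ^+ 20 <= u ^+ 20 by rewrite ler_piMl // exprn_ge0 // ltW.
rewrite hN; have := uX 10; have := uX 20; lra.
Qed.

Lemma good_couplings_absorb (T : nat) (J : couplings N) :
  384 / p ^+ 2 * u ^+ 10 <= u ^+ 9 / 2 + mu p u / 16 / 2 * T%:R ->
  u ^+ 9 / 2 + mu p u / 16 / 2 * T%:R < (1 - p / 4) * N%:R ->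
  discrepancy p u J -> rich p J -> early p u x0 T J ->
  (forall i, flip_prob R J (@all_plus N) i = 0) /\ exists n, miss R J n x0 <= 2 * expR (- u).
Proof.
move=> hT1 hT2 hdisc hrich hearly.
have u1 := u_ge1; have u0 : 0 < u by exact: lt_le_trans ltr01 u1.
have NR : 0 < N%:R :> R by rewrite hN exprn_gt0.
have N0 : (0 < N)%N by rewrite -(ltr0n R).
split=> [i|].
  have hi : 0 < local_field R [set: 'I_N]%SET (@all_plus N) J i.
    apply: (rich_field hp0 u1 hN) => //; rewrite mag_all_plus ler_piMl ?ler0n //.
    by move: hp0; lra.
  by rewrite flip_probE gtr0_sg // ffunE /spin mulr1 subrr mulr0.
pose dl := mu p u / 16.
have u300 : 0 < 300 * u by exact: mulr_gt0 (ltr0Sn _ _) u0.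
have mu0 : 0 < mu p u by exact: divr_gt0.
have dl0 : 0 < dl by exact: divr_gt0 mu0 (ltr0Sn _ _).
have mup : mu p u <= p.
  by rewrite /mu ler_pdivrMr // ler_peMr ?ltW //; move: u1; lra.
have dl8 : dl <= p / 8 by rewrite /dl; move: mup hp0; lra.
have dl1 : dl <= 1 by move: dl8 hp1; lra.
have low s : 384 / p ^+ 2 * u ^+ 10 <= mag s -> mag s <= (1 - p / 4) * N%:R -> dl * N%:R <= pull R s J.
  move=> h1 h2; apply: le_trans (discrepancy_pull hp0 hp1 u1 hN hdisc h1 h2).
  by rewrite ler_wpM2r ?ler0n.
have [||||n hn] := @miss_small R N J N0 (dl / 32) dl dl0 dl1 erefl
  ((1 - p / 4) * N%:R) (u ^+ 9 / 2) x0 T _ _ _ _ (expR (- u)) (expR_gt0 _).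
- by move=> s h1 h2; apply: low => //; exact: le_trans hT1 h1.
- move=> s sT h1 h2; have [h3|h3] := leP (384 / p ^+ 2 * u ^+ 10) (mag s).
    by apply: low => //; exact: ltW (lt_trans h2 hT2).
  move: hearly => /forallP /(_ s) /implyP /(_ sT) /implyP /(_ h1) /implyP /(_ (ltW h3)).
  by [].
- by move=> s i; exact: (rich_field hp0 u1 hN).
- exact: hT2.
exists n; apply: (le_trans hn).
suff : expR (- (dl / 32) * (mag x0 - u ^+ 9 / 2)) <= expR (- u) by lra.
rewrite ler_expR mulNr lerN2.
have hu9 : 4800 * 64 / p <= u by move: hu => /= /and5P[_ _ _ _ /and5P[_ _ _ _ /and3P[]]].
have : 4800 * 64 / p * u ^+ 1 <= u ^+ 8 by exact: dominate.
rewrite expr1 mulrAC ler_pdivrMr // => hd.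
apply: (@le_trans _ _ (dl / 32 * (u ^+ 9 / 2))); last first.
  by rewrite ler_pM2l ?divr_gt0 //; move: hx0; lra.
have -> : dl / 32 * (u ^+ 9 / 2) = u ^+ 8 * p / (4800 * 64).
  by rewrite /dl /mu; field; exact: lt0r_neq0.
by move: hd; lra.
Qed.

Lemma not_absorbed_small (d : measure_display) (T : measurableType d) (P : probability T R)
  (J : T -> couplings N) (X : nat -> T -> config N) :
  zero_temp_dynamics p x0 P J X -> (P (~` absorbed R X) <= (5 * expR (- u))%:E)%E.
Proof.
move=> H; have [t [ht1 ht2 ht3]] := drift_time; have u1 := u_ge1.
pose good (j : couplings N) := [&& discrepancy p u j, rich p j & early p u x0 t j].
apply: le_trans (not_absorbed_le H (good := good) hp0 hp1 (e := 2 * expR (- u)) _ _) _.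
- by rewrite mulr_ge0 // expR_ge0.
- by move=> j /and3P[]; exact: good_couplings_absorb.
rewrite lee_fin.
suff : Pr p (predC good) <= expR (- u) + (expR (- u) + expR (- u)) by lra.
apply: (@le_trans _ _ (Pr p (fun j : couplings N =>
    ~~ discrepancy p u j || (~~ rich p j || ~~ early p u x0 t j)))).
  by apply: le_Pr => // j; rewrite /= !negb_and.
move: hu => /= /and5P[_ a2 a3 a4 /and5P[a5 a6 a7 a8 _]].
apply: (le_trans (Pr_or hp0 hp1 _ _)); apply: lerD; first exact: (pr_discrepancy hp0 hp1 u1 hN).
apply: (le_trans (Pr_or hp0 hp1 _ _)); apply: lerD; first exact: (pr_rich hp0 hp1 u1 hN a8).
apply: (pr_early hp0 hp1 u1 hN x0 a2 a3 a4 a5 ht1 _ erefl erefl a6 a7).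
apply: addr_ge0 ler01; apply: divr_ge0 (exprn_ge0 _ (ltW hp0)).
exact: mulr_ge0 (ler0n _ _) (ler0n _ _).
Qed.

End FixedSize.

End Assembly.

Theorem theorem1 (R : realType) (p : R) (hp : 0 < p <= 1) :
  exists2 eps0 : R, 0 < eps0 &
    forall eps : R, 0 < eps < eps0 ->
    forall x0 : forall N : nat, config N,
      (forall N : nat, (0 < N)%N ->
         N%:R `^ (2^-1 - eps) <= magnetization R (x0 N)) ->
    forall (d : nat -> measure_display)
           (T : forall N : nat, measurableType (d N))
           (P : forall N : nat, probability (T N) R)
           (J : forall N : nat, T N -> couplings N)
           (X : forall N : nat, nat -> T N -> config N),
      (forall N : nat, zero_temp_dynamics p (x0 N) (P N) (J N) (X N)) ->
      (fun N : nat =>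
         P N [set w : T N |
                (fun t : nat => spins R (X N t w)) @ \oo
                  --> (const_mx 1 : 'rV[R]_N)])
        @ \oo --> 1%E.
Proof.
have /andP[hp0 hp1] := hp.
exists 20^-1; first by rewrite invr_gt0 ltr0n.
move=> eps /andP[e0 e1] x0 hx0 d T P J X H.
pose u N : R := N%:R `^ 20^-1.
have hu20 N : N%:R = u N ^+ 20.
  by rewrite /u -powR_mulrn ?powR_ge0 // -powRrM mulVf ?pnatr_eq0 // powRr1 ?ler0n.
have large (c : R) : \forall N \near \oo, c <= u N.
  pose c' := Num.max c 0.
  have c0 : 0 <= c' by rewrite le_max lexx orbT.
  exists (Num.truncn (c' ^+ 20)).+1 => // N /= hN.
  apply: (@le_trans _ _ c'); first by rewrite le_max lexx.
  rewrite -(@ler_pXn2r _ 20) ?nnegrE ?powR_ge0 // -hu20.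
  have := truncn_itv (exprn_ge0 20 c0) => /andP[_ /ltW h]; apply: (le_trans h).
  by rewrite ler_nat.
have bound : \forall N \near \oo, (P N (~` absorbed R (X N)) <= (5 * expR (- u N))%:E)%E.
  have hall : \forall N \near \oo, all (fun c => c <= u N) (thresholds p).
    elim: (thresholds p) => [|c s IH]; first exact: nearW.
    by near=> N; apply/andP; split; near: N; [exact: large|exact: IH].
  near=> N.
  have hN : all (fun c => c <= u N) (thresholds p) by near: N; exact: hall.
  have N0 : (0 < N)%N by near: N; exists 1%N.
  apply: (not_absorbed_small hp0 hp1 hN (hu20 N) _ (H N)).
  apply: le_trans (hx0 N N0).
  rewrite /u -powR_mulrn ?powR_ge0 // -powRrM; apply: ler_powR; first by rewrite ler1n.
  lra.
have fin N : P N (~` absorbed R (X N)) \is a fin_num.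
  exact: fin_num_measure (measurableC (measurable_absorbed (H N))).
have fin' N : P N (absorbed R (X N)) \is a fin_num.
  exact: fin_num_measure (measurable_absorbed (H N)).
apply/fine_cvgP; split; first by apply: nearW => N; exact: fin'.
apply/cvgrPdist_le => e epos; near=> N.
have h1 : (P N (~` absorbed R (X N)) <= (5 * expR (- u N))%:E)%E by near: N.
have h2 : 5 / e <= u N by near: N; exact: large.
have h3 : (P N (~` absorbed R (X N)) = 1 - P N (absorbed R (X N)))%E.
  exact: probability_setC (measurable_absorbed (H N)).
have h0 : (0 <= P N (~` absorbed R (X N)))%E by exact: measure_ge0.
have h1' : 1 - fine (P N (absorbed R (X N))) <= 5 * expR (- u N).
  by rewrite -lee_fin EFinB fineK // -h3.
have h0' : 0 <= 1 - fine (P N (absorbed R (X N))).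
  by rewrite -lee_fin EFinB fineK // -h3.
rewrite ger0_norm //; apply: (le_trans h1').
rewrite expRN ler_pdivrMr ?expR_gt0 // mulrC -ler_pdivrMr //.
apply: (le_trans h2); apply: le_trans (expR_ge1Dx _); by rewrite lerDr.
Unshelve. all: by end_near.
Qed.
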